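(* For all positive integers $a,b,s,x$ with $x\leq a$ and all integers $k_1,k_2,\dotsc,k_s$ with $0< k_1<k_2<\dots<k_s\le a/2$, we have $$ \operatorname{M}_{\odot}(H_{a,2b}(k_1,k_2,\dotsc,k_s)) = \operatorname{M}_{\odot,|}(H_{a,2b}(k_1,k_2,\dotsc,k_s))^2, $$ and $$ \operatorname{M}_{\odot}(H_{2a-1,2b}(k_1,k_2,\dotsc,k_s;2x-1)) = \operatorname{M}_{\odot,|}(H_{2a-1,2b}(k_1,k_2,\dotsc,k_s;2x-1))^2, $$ where $\odot$ denotes symmetry with respect to the center of the region (equivalently, invariance under rotation by $180^\circ$ around its center).
   Context: Work on the triangular lattice drawn so that one family of lattice lines is vertical. For a lattice region $R$, $\operatorname{M}(R)$ denotes the number of lozenge tilings of $R$, and $\operatorname{M}_{s_1,\dotsc,s_k}(R)$ denotes the number of lozenge tilings of $R$ invariant under the symmetries $s_1,\dotsc,s_k$; here $|$ denotes reflection across the vertical symmetry axis and $\odot$ denotes rotation by $180^\circ$ about the center. For positive integers $a,b,s$ and $0<k_1<\dots<k_s\le a/2$, $H_{a,2b}(k_1,\dotsc,k_s)$ is the region obtained from the hexagon with side lengths $a,a,2b,a,a,2b$ (clockwise, starting from the northwestern side) by removing $2s$ triangles of side-length two along its horizontal symmetry axis: $s$ left-pointing such triangles whose vertical sides are at distances $2k_1,\dotsc,2k_s$ from the left side of the hexagon (in units of $\sqrt{3}$ times the lattice spacing), together with their reflections across the vertical symmetry axis of the hexagon. When the first parameter is odd, $2a-1$, this region has a horizontal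 lattice rhombus of odd side-length at its center; for a positive integer $x\le a$, $H_{2a-1,2b}(k_1,\dotsc,k_s;2x-1)$ denotes the region obtained from $H_{2a-1,2b}(k_1,\dotsc,k_s)$ by removing from its center the horizontal lattice rhombus of side $2x-1$.
   Formalization: The distances 2k_i of the vertical sides of the removed triangles from the left side are measured in units of √3/2 (not √3) times the lattice spacing, so that k_s ≤ a/2 places the left-pointing triangles in the left half; with unit √3 the claim fails (a=5, b=1, k_1=2 gives 3 versus 1). *)

(* Defs.v *)
From HB Require Import structures.
From mathcomp Require Import all_boot all_order all_algebra.
From mathcomp Require Import finmap.
Set Implicit Arguments. Unset Strict Implicit. Unset Printing Implicit Defensive.
Import Order.TTheory GRing.Theory Num.Theory.
Local Open Scope ring_scope.


(** * Coordinates on the triangular lattice (one family of lines vertical).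
    Unit side length 1.  Vertical lattice lines are x = k * (sqrt 3 / 2),
    k : int; we record the index k.  Vertical positions are recorded doubled:
    a point at height y is stored as Y = 2y.  Lattice vertices are the points
    (k, Y) with Y = k (mod 2).  Slanted lattice lines have slope +-1 in these
    (k, Y) coordinates. *)
Definition pt := (int * int)%type.

(** A unit triangle [(k, m)] lies in the strip between lines k and k+1;
    [m] is the Y-coordinate of the midpoint of its vertical side (= Y of its
    apex).  If k + m is even it points left (apex (k,m), vertical side on
    line k+1 from m-1 to m+1), otherwise it points right (vertical side on
    line k from m-1 to m+1, apex (k+1,m)). *)
Definition tri := (int * int)%type.

Definition left_pointing (t : tri) : bool := ~~ odd (absz (t.1 + t.2)).

Definition tri_vertices (t : tri) : seq pt :=
  if left_pointing t then [:: (t.1, t.2); (t.1 + 1, t.2 - 1); (t.1 + 1, t.2 + 1)]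
  else [:: (t.1, t.2 - 1); (t.1, t.2 + 1); (t.1 + 1, t.2)].

Definition adjacent (t u : tri) : bool :=
  ((t.1 == u.1) && ((u.2 == t.2 + 1) || (t.2 == u.2 + 1)))
  || ((t.2 == u.2) &&
      (((u.1 == t.1 + 1) && left_pointing t) || ((t.1 == u.1 + 1) && left_pointing u))).

(** A unit triangle lies in a closed convex lattice polygon P iff its three
    vertices do. *)
Definition tri_in (P : pt -> bool) (t : tri) : bool := all P (tri_vertices t).

(** Hexagon with sides A, A, 2B, A, A, 2B (clockwise from the NW side),
    left vertical side on line 0 from y = -B to y = B, right side on line 2A;
    center (A, 0). *)
Definition in_hex (A B : nat) (p : pt) : bool :=
  [&& 0 <= p.1, p.1 <= (2 * A)%:Z,
      `|p.2| <= (2 * B)%:Z + p.1 & `|p.2| <= (2 * B)%:Z + ((2 * A)%:Z - p.1)].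

(** Left-pointing triangle of side 2 with apex (p0, 0) and vertical side on
    line p0+2 (from y = -1 to y = 1). *)
Definition in_ltri2 (p0 : int) (p : pt) : bool :=
  [&& p0 <= p.1, p.1 <= p0 + 2 & `|p.2| <= p.1 - p0].

(** Right-pointing triangle of side 2 with vertical side on line q
    (from y = -1 to y = 1) and apex (q+2, 0). *)
Definition in_rtri2 (q : int) (p : pt) : bool :=
  [&& q <= p.1, p.1 <= q + 2 & `|p.2| <= q + 2 - p.1].

(** Horizontal lattice rhombus of side n centred at (c, 0):
    vertices (c - n, 0), (c, n/2), (c + n, 0), (c, -n/2) in true heights. *)
Definition in_rhomb (c : int) (n : nat) (p : pt) : bool :=
  `|p.1 - c| + `|p.2| <= n%:Z.

(** The removed triangles: for each k in ks, the left-pointing side-2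
    triangle whose vertical side is on line 2k (distance 2k from the left
    side, counted in spacings sqrt 3 / 2 between vertical lattice lines),
    and its mirror image across the vertical axis x = A. *)
Definition in_holes (A : nat) (ks : seq nat) (t : tri) : bool :=
  has (fun k : nat => tri_in (in_ltri2 ((2 * k)%:Z - 2)) t
                     || tri_in (in_rtri2 ((2 * A)%:Z - (2 * k)%:Z)) t) ks.

(** A finite list of unit triangles containing every unit triangle of the
    hexagon with parameters A, B. *)
Definition box (A B : nat) : seq tri :=
  [seq (k%:Z, j%:Z - (2 * B + A)%:Z) | k <- iota 0 (2 * A), j <- iota 0 (2 * (2 * B + A)).+1].

Definition Hreg (A B : nat) (ks : seq nat) : {fset tri} :=
  [fset t | t in [seq t <- box A B | tri_in (in_hex A B) t && ~~ in_holes A ks t]]%fset.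

Definition HregR (A B : nat) (ks : seq nat) (n : nat) : {fset tri} :=
  [fset t | t in [seq t <- box A B | [&& tri_in (in_hex A B) t, ~~ in_holes A ks t
                                       & ~~ tri_in (in_rhomb A%:Z n) t]]]%fset.

(** Lozenge tilings of a region R = perfect matchings of its unit triangles
    into adjacent pairs; encoded by the partner map f (an involution pairing
    each triangle with an adjacent one).  This is a bijection with the sets of
    lozenges partitioning R. *)
Definition is_tiling (R : {fset tri}) (f : {ffun R -> R}) : bool :=
  [forall t : R, adjacent (val t) (val (f t)) && (f (f t) == t)].

Definition invariant_under (R : {fset tri}) (sg : tri -> tri) (f : {ffun R -> R}) : bool :=
  [forall t : R, forall u : R, (val u == sg (val t)) ==> (val (f u) == sg (val (f t)))].

Definition Msym (R : {fset tri}) (syms : seq (tri -> tri)) : nat :=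
  #|[set f : {ffun R -> R} | is_tiling f && all (fun sg => invariant_under sg f) syms]|.

(** Rotation by 180 degrees about the centre (A, 0) of a region of width
    parameter A: point (x, Y) |-> (2A - x, -Y). *)
Definition rot180 (A : nat) (t : tri) : tri := ((2 * A)%:Z - 1 - t.1, - t.2).

(** Reflection across the vertical symmetry axis x = A: (x, Y) |-> (2A - x, Y). *)
Definition reflV (A : nat) (t : tri) : tri := ((2 * A)%:Z - 1 - t.1, t.2).

(* Main.v *)
Require Import Defs.
From HB Require Import structures.
From mathcomp Require Import all_boot all_order all_algebra.
From mathcomp Require Import finmap.
From mathcomp Require Import fingroup perm zify ring.

(** Read the slanted lozenges of the left half of a centrally symmetric tiling as non-intersecting
    walkers with steps +-1, moving from one vertical lattice line to the next: the left side of
    the hexagon emits walkers at the odd heights, and the vertical side of each removed triangle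
    emits two more, at heights -1 and 1.  The tilings invariant under the rotation correspond to
    the families whose set of end points on the vertical axis is symmetric about the horizontal
    axis; those invariant under both symmetries correspond to the families symmetric about the
    horizontal axis, that is, to families of n walkers confined to positive heights.

    Let X_ij and Y_ij count the walks from the i-th positive starting point to the heights j and
    -j.  The reflection principle turns the second count into S = sum_T det (X - Y)_T, over all
    sets T of n columns, while the first one is
      sum_T det [[X, Y], [Y, X]]_T = sum_T det (X - Y)_T det (X + Y)_T = det ((X - Y)(X + Y)^T).
    After unitriangular row operations every walker starts at height 1, and with P = X - Y one
    gets (X + Y)^T = L P^T on the columns that matter, where L has entries 1 on and 2 above the
    diagonal.  It remains to see that det (P L P^T) = S^2 for every integer matrix P with nonzero
    row sums v.  Here E = P L P^T satisfies E + E^T = 2 v^T v, and the minor sums satisfy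
      S(x, l_1, .., l_n) = v(x) S(l) - sum_j (-1)^(j-1) E(l_j, x) S(l without l_j),
    so that, putting x = l_i, the vector of signed sums S(l without l_j) times E equals S(l) v;
    the identity follows by induction on n through the adjugate of E. *)

Set Implicit Arguments. Unset Strict Implicit. Unset Printing Implicit Defensive.
Import Order.TTheory GRing.Theory Num.Theory.
Local Open Scope ring_scope.

(** * Antisymmetric functions of sequences and the sign of a sequence *)

Definition antisym_seq (T : Type) (g : seq T -> int) : Prop :=
  forall pre x y post, g (pre ++ x :: y :: post) = - g (pre ++ y :: x :: post).

Lemma antisym_seq_cons (T : Type) (g : seq T -> int) z :
  antisym_seq g -> antisym_seq (fun r => g (z :: r)).
Proof. by move=> ag pre x y post; rewrite -!cat_cons ag. Qed.

(* The signed sum of [w x * g (l without x)] over the entries [x] of [l]; see [contrE]. *)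
Fixpoint contr (T : Type) (w : T -> int) (g : seq T -> int) (l : seq T) : int :=
  if l is x :: l' then w x * g l' - contr w (fun r => g (x :: r)) l' else 0.

Section Contr.
Variables (T : Type) (w : T -> int).
Implicit Types g : seq T -> int.

Lemma eq_contr g g' l : g =1 g' -> contr w g l = contr w g' l.
Proof.
elim: l g g' => //= x l IHl g g' egg; rewrite egg.
by congr (_ - _); apply: IHl => r; apply: egg.
Qed.

Lemma contrN g l : contr w (fun r => - g r) l = - contr w g l.
Proof. by elim: l g => [|x l IHl] g /=; rewrite ?oppr0 // IHl mulrN opprB addrC opprK. Qed.

Lemma contr_sum (I : finType) (a : I -> int) (G : I -> seq T -> int) l :
  contr w (fun r => \sum_i a i * G i r) l = \sum_i a i * contr w (G i) l.
Proof.
elim: l G => [|x l IHl] G /=; first by rewrite big1 // => i _; rewrite mulr0.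
rewrite IHl mulr_sumr -sumrB; apply: eq_bigr => i _.
by rewrite mulrBr mulrCA.
Qed.

(** The two terms deleting one of the swapped entries exchange with opposite signs; in every other
    term the swap takes place inside [g]. *)
Lemma antisym_contr g : antisym_seq g -> antisym_seq (contr w g).
Proof.
move=> ag pre; elim: pre g ag => [|z pre IHp] g ag x y post /=.
  suff -> : contr w (fun r => g [:: y, x & r]) post
            = - contr w (fun r => g [:: x, y & r]) post by ring.
  by rewrite -contrN; apply: eq_contr => r; apply: (ag [::]).
rewrite ag (IHp (fun r => g (z :: r)) (antisym_seq_cons z ag) x y post).
by rewrite mulrN opprB opprK addrC.
Qed.

Definition rem_at (j : nat) (l : seq T) := take j l ++ drop j.+1 l.

Lemma contrE (x0 : T) g l :
  contr w g l = \sum_(j < size l) (-1) ^+ j * (w (nth x0 l j) * g (rem_at j l)).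
Proof.
elim: l g => [|x l IHl] g /=; first by rewrite big_ord0.
rewrite IHl big_ord_recl /= expr0 mul1r /rem_at /= drop0; congr (_ + _).
rewrite -sumrN; apply: eq_bigr => i _.
by rewrite /bump leq0n add1n exprS mulN1r mulNr.
Qed.

Lemma size_rem_at j l : (j < size l)%N -> size (rem_at j l) = (size l).-1.
Proof. by move=> jl; rewrite /rem_at size_cat size_take size_drop jl; lia. Qed.

Lemma nth_rem_at (x0 : T) j l i : (j < size l)%N -> nth x0 (rem_at j l) i = nth x0 l (bump j i).
Proof.
move=> jl; rewrite /rem_at nth_cat size_take jl /bump.
case: ltnP => ij; first by rewrite nth_take // leqNgt ij.
by rewrite nth_drop add1n; congr nth; lia.
Qed.

End Contr.

(** * Antisymmetric functions determined by increasing sequences *)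

Section Insertion.
Variables (N : nat) (H : seq 'I_N -> int).
Hypothesis aH : antisym_seq H.
Hypothesis H0 : forall t, sorted (fun c d : 'I_N => c < d)%N t -> H t = 0.

Lemma antisym_adj pre x post : H (pre ++ x :: x :: post) = 0.
Proof. by have := aH pre x x post; lia. Qed.

Lemma antisym_le_sorted t : sorted (fun c d : 'I_N => c <= d)%N t -> H t = 0.
Proof.
have [/H0 //|] := boolP (sorted (fun c d : 'I_N => c < d)%N t).
case: t => //= x t.
suff gen pre : ~~ path (fun c d : 'I_N => c < d)%N x t ->
    path (fun c d : 'I_N => c <= d)%N x t -> H (pre ++ x :: t) = 0 by exact: (gen [::]).
elim: t pre x => //= y t IHt pre x; rewrite negb_and -leqNgt.
have [xy|xy] := leqP y x => /=.
  move=> _ /andP[yx _]; have -> : x = y by apply: val_inj => /=; apply/eqP; rewrite eqn_leq xy yx.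
  exact: antisym_adj.
by move=> nlt /andP[_ le]; rewrite -cat_rcons; apply: IHt.
Qed.

Fixpoint ins (x : 'I_N) (l : seq 'I_N) :=
  if l is y :: l' then if (x <= y)%N then x :: l else y :: ins x l' else [:: x].

Lemma ins_sorted x l :
  sorted (fun c d : 'I_N => c <= d)%N l -> sorted (fun c d : 'I_N => c <= d)%N (ins x l).
Proof.
case: l => //= y l; case: (leqP x y) => [xy ll|]; first by rewrite /= xy.
elim: l y => /= [|z l IHl] y yx; first by rewrite (ltnW yx).
case/andP=> yz zl; case: (leqP x z) => [xz|zx] /=; first by rewrite (ltnW yx) xz.
by rewrite yz; apply: IHl.
Qed.

Lemma antisym_ins pre x l : H (pre ++ ins x l) = 0 -> H (pre ++ x :: l) = 0.
Proof.
elim: l pre => //= y l IHl pre; case: leqP => // _ Hy.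
by rewrite aH -cat_rcons IHl ?oppr0 // cat_rcons.
Qed.

(** Insertion sort: each swap only changes the sign, so it suffices to treat sorted sequences, and
    those with a repetition vanish by antisymmetry. *)
Lemma antisym_eq0 t : H t = 0.
Proof.
suff gen l pre : (forall l', sorted (fun c d : 'I_N => c <= d)%N l' -> H (pre ++ l') = 0) ->
    H (pre ++ l) = 0 by apply: (gen t [::]) => l'; apply: antisym_le_sorted.
elim: l pre => [|x l IHl] pre Hs; first exact: Hs.
rewrite -cat_rcons; apply: IHl => l' sl'; rewrite cat_rcons; apply: antisym_ins.
by apply: Hs; apply: ins_sorted.
Qed.
End Insertion.

(** * The sign of a sequence and its behaviour under a new first entry *)

Section Eps.
Variable N : nat.
Implicit Types (t : seq 'I_N) (c d u : 'I_N).

Definition osg c d : int := if (c < d)%N then 1 else if (d < c)%N then -1 else 0.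

Lemma osgC c d : osg c d = - osg d c.
Proof. by rewrite /osg; case: ltngtP; rewrite ?opprK ?oppr0. Qed.

(* The sign of the permutation sorting [t], or 0 if [t] has a repetition. *)
Fixpoint eps t : int := if t is x :: t' then (\prod_(y <- t') osg x y) * eps t' else 1.

Lemma antisym_eps : antisym_seq eps.
Proof.
move=> pre x y post; elim: pre => [|z pre IHp] /=.
  by rewrite !big_cons [osg y x]osgC; ring.
by rewrite IHp !big_cat /= !big_cons; ring.
Qed.

Lemma eq_contr_subseq w (g g' : seq 'I_N -> int) t :
  (forall r, subseq r t -> g r = g' r) -> contr w g t = contr w g' t.
Proof.
elim: t g g' => //= x t IHt g g' egg.
rewrite egg; last exact: subseq_cons.
by congr (_ - _); apply: IHt => r rt; apply: egg; rewrite /= eqxx.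
Qed.

Lemma eps_cons_lt (x : 'I_N) t : all (fun y : 'I_N => x < y)%N t -> eps (x :: t) = eps t.
Proof.
move=> /allP xt /=; rewrite big_seq big1 ?mul1r // => y /xt xy.
by rewrite /osg xy.
Qed.

Lemma eps_sorted t : sorted (fun c d => c < d)%N t -> eps t = 1.
Proof.
elim: t => // x t IHt xt; rewrite eps_cons_lt ?IHt //; first exact: path_sorted xt.
by apply: order_path_min xt => a b c; apply: ltn_trans.
Qed.

Lemma contr_eps_sorted w (x : 'I_N) t : sorted (fun c d => c < d)%N (x :: t) ->
  contr w eps (x :: t) = w x - contr w eps t.
Proof.
move=> xt; have xlt: all (fun y : 'I_N => x < y)%N t.
  by apply: order_path_min xt => a b c; apply: ltn_trans.
rewrite [LHS]/= eps_sorted ?mulr1; last exact: path_sorted xt.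
congr (_ - _); apply: eq_contr_subseq => r rt.
by apply: eps_cons_lt; apply/allP => y /(mem_subseq rt); apply: (allP xlt).
Qed.

(** Both sides are antisymmetric in [t], so [t] may be taken increasing. The contraction is then the
    alternating sum of weights 2 for entries below [u], 1 for [u] itself and 0 above; with p entries
    below [u], both sides are (-1)^p if [u] is absent from [t], and 0 otherwise. *)
Lemma eps_cons u t : eps (u :: t) = eps t - contr (fun c => 1 + osg c u) eps t.
Proof.
pose H t := eps (u :: t) - eps t + contr (fun c => 1 + osg c u) eps t.
suff : H t = 0 by rewrite /H; lia.
move: t; apply: antisym_eq0.
  move=> pre x y post; rewrite /H (antisym_contr _ antisym_eps) (antisym_eps pre).
  by rewrite -cat_cons antisym_eps cat_cons; ring.
move=> t st; rewrite /H [eps (u :: t)]/= eps_sorted // mulr1.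
elim: t st => [|x t IHt] st; first by rewrite big_nil /=; ring.
rewrite contr_eps_sorted // big_cons.
have := IHt (path_sorted st); move: (contr _ _ _) => C.
have /allP xt: all (fun y : 'I_N => x < y)%N t.
  by apply: order_path_min st => a b c; apply: ltn_trans.
rewrite [osg x u]osgC; have [xu|ux] := ltnP x u.
  have -> : osg u x = -1 by rewrite /osg xu ltnNge (ltnW xu).
  by lia.
rewrite big_seq big1; first lia.
by move=> y /xt xy; rewrite /osg (leq_ltn_trans ux xy).
Qed.

End Eps.

(** * Sums of maximal minors *)

(** Sequences of all lengths are allowed, so that fixing some of the rows gives a function of the
    same kind. All row operations below go through this interface. *)
Definition altmul (V : zmodType) (F : seq V -> int) : Prop :=
  (forall l1 u v l2, F (l1 ++ (u + v) :: l2) = F (l1 ++ u :: l2) + F (l1 ++ v :: l2))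
  /\ antisym_seq F.

Inductive span (V : zmodType) (P : V -> Prop) : V -> Prop :=
| span_mem v of P v : span P v
| span_zero : span P 0
| span_add u v of span P u & span P v : span P (u + v)
| span_opp u of span P u : span P (- u).

Section Altmul.
Variables (V : zmodType).
Implicit Types (F : seq V -> int) (l : seq V).

Lemma altmul_cons F z : altmul F -> altmul (fun r => F (z :: r)).
Proof.
by case=> aF sF; split=> [l1 u v l2|]; [rewrite -!cat_cons aF | apply: antisym_seq_cons].
Qed.

Lemma altmul_cat F l : altmul F -> altmul (fun r => F (l ++ r)).
Proof.
case=> aF sF; split=> [l1 u v l2|pre x y post]; first by rewrite !catA aF.
by rewrite !catA sF.
Qed.

Lemma altmul0 F l1 l2 : altmul F -> F (l1 ++ 0 :: l2) = 0.
Proof. by case=> aF _; have /eqP := aF l1 0 0 l2; rewrite addr0 -subr_eq subrr => /eqP <-. Qed.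

Lemma altmulN F l1 u l2 : altmul F -> F (l1 ++ - u :: l2) = - F (l1 ++ u :: l2).
Proof.
move=> FF; apply/eqP; rewrite -addr_eq0 addrC -FF.1 subrr; apply/eqP; exact: altmul0.
Qed.

Lemma altmul_dup F u l2 l3 : altmul F -> F (u :: l2 ++ u :: l3) = 0.
Proof.
elim: l2 F => [|v l2 IHl] F FF /=; first by have := FF.2 [::] u u l3; rewrite /=; lia.
rewrite (FF.2 [::] u v) /=.
by rewrite (IHl (fun r => F (v :: r))) ?oppr0 //; apply: altmul_cons.
Qed.

Lemma altmul_dup_mem F u l1 l2 : altmul F -> u \in l1 ++ l2 -> F (l1 ++ u :: l2) = 0.
Proof.
move=> FF; rewrite mem_cat => /orP[] /splitPr[p q].
  rewrite -catA /= ; apply: (altmul_dup u q l2 (altmul_cat p FF)).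
exact: (altmul_dup u p q (altmul_cat l1 FF)).
Qed.

Lemma altmul_span F l1 l2 w : altmul F ->
  span (fun u => u \in l1 ++ l2) w -> F (l1 ++ w :: l2) = 0.
Proof.
move=> FF; elim=> [u|| u v _ IHu _ IHv | u _ IHu]; first exact: altmul_dup_mem.
- exact: altmul0.
- by rewrite FF.1 IHu IHv.
- by rewrite altmulN // IHu oppr0.
Qed.

Lemma altmul_add_span F l1 l2 u w : altmul F ->
  span (fun u => u \in l1 ++ l2) w -> F (l1 ++ (u + w) :: l2) = F (l1 ++ u :: l2).
Proof. by move=> FF sw; rewrite FF.1 (altmul_span FF sw) addr0. Qed.

Lemma altmul_move1 F a l r : altmul F ->
  F (l ++ a :: r) = (-1) ^+ size l * F (a :: l ++ r).
Proof.
elim: l F => [|y l IHl] F FF /=; first by rewrite mul1r.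
rewrite (IHl _ (altmul_cons y FF)) (FF.2 [::] y a) /= exprS; ring.
Qed.

(** The signs of the two moves are equal, so a pair of rows can be moved as a block without a
    sign. *)
Lemma altmul_move2 F a b l r : altmul F -> F (l ++ a :: b :: r) = F (a :: b :: l ++ r).
Proof.
move=> FF; rewrite altmul_move1 // (altmul_move1 b l r (altmul_cons a FF)).
by rewrite mulrA -exprMn mulrNN mulr1 expr1n mul1r.
Qed.

Definition pairs (tw : V -> V) l := flatten [seq [:: tw x; x] | x <- l].

Lemma pairs_cat tw l1 l2 : pairs tw (l1 ++ l2) = pairs tw l1 ++ pairs tw l2.
Proof. by rewrite /pairs map_cat flatten_cat. Qed.

(** In the nested arrangement the innermost [tw x] and [x] are adjacent, hence can be moved to the
    front as a block. *)
Lemma altmul_pairs F (tw : V -> V) l r : altmul F ->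
  F (rev (map tw l) ++ l ++ r) = F (pairs tw l ++ r).
Proof.
elim: l F r => [|x l IHl] F r FF //=.
rewrite rev_cons cat_rcons altmul_move2 //.
exact: (IHl _ _ (altmul_cons x (altmul_cons (tw x) FF))).
Qed.

End Altmul.

Section Ext.
Variable N : nat.
Implicit Types (g : seq 'I_N -> int) (x y : 'rV[int]_N) (l : seq 'rV[int]_N).

(* The multilinear extension of [g] from sequences of basis vectors to sequences of vectors. *)
Fixpoint ext g l : int :=
  if l is x :: l' then \sum_c x 0 c * ext (fun f => g (c :: f)) l' else g [::].

Lemma eq_ext g g' l : g =1 g' -> ext g l = ext g' l.
Proof.
elim: l g g' => [|x l IHl] g g' egg /=; first exact: egg.
by apply: eq_bigr => c _; congr (_ * _); apply: IHl => f; apply: egg.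
Qed.

Lemma extN g l : ext (fun f => - g f) l = - ext g l.
Proof.
elim: l g => //= x l IHl g; rewrite -sumrN; apply: eq_bigr => c _.
by rewrite IHl mulrN.
Qed.

Lemma extD g g' l : ext (fun f => g f + g' f) l = ext g l + ext g' l.
Proof.
elim: l g g' => //= x l IHl g g'; rewrite -big_split; apply: eq_bigr => c _.
by rewrite IHl mulrDr.
Qed.

Lemma extZ a g l : ext (fun f => a * g f) l = a * ext g l.
Proof.
elim: l g => //= x l IHl g; rewrite mulr_sumr; apply: eq_bigr => c _.
by rewrite IHl mulrCA.
Qed.

Lemma altmul_ext g : antisym_seq g -> altmul (ext g).
Proof.
move=> ag; split.
  move=> l1 u v l2; elim: l1 g {ag} => [|x l1 IHl] g /=.
    by rewrite -big_split; apply: eq_bigr => c _; rewrite mxE mulrDl.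
  by rewrite -big_split; apply: eq_bigr => c _; rewrite IHl mulrDr.
move=> l1 u v l2; elim: l1 g ag => [|x l1 IHl] g ag /=; last first.
  rewrite -sumrN; apply: eq_bigr => c _; rewrite IHl ?mulrN //.
  exact: antisym_seq_cons.
under eq_bigr do rewrite mulr_sumr; rewrite exchange_big /= -sumrN.
apply: eq_bigr => c _; rewrite mulr_sumr -sumrN; apply: eq_bigr => d _.
rewrite mulrCA -!mulrN -extN; congr (_ * (_ * _)); apply: eq_ext => f.
exact: (ag [::]).
Qed.

Lemma ext_contr (w : 'I_N -> int) g l :
  ext (contr w g) l = contr (fun x => \sum_c x 0 c * w c) (ext g) l.
Proof.
elim: l g => //= x l IHl g.
rewrite (contr_sum _ (fun c => x 0 c) (fun c => ext (fun f => g (c :: f)))).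
rewrite mulr_suml -sumrB; apply: eq_bigr => c _.
by rewrite extD extZ extN IHl mulrBr mulrA.
Qed.

(* The sum of all maximal minors of the matrix with rows [l]. *)
Definition minors_sum := ext (@eps N).
Definition vsum x : int := \sum_c x 0 c.
(** The bilinear form with matrix L of the overview: [1 + osg c d] is 1 on the diagonal, 2 above it
    and 0 below. *)
Definition lform x y : int := \sum_c \sum_d x 0 c * y 0 d * (1 + osg c d).

Lemma altmul_minors_sum : altmul minors_sum.
Proof. exact/altmul_ext/antisym_eps. Qed.

(** The multilinear extension of [eps_cons]; multilinear extension and contraction commute by
    [ext_contr]. *)
Lemma minors_sum_cons x l :
  minors_sum (x :: l) = vsum x * minors_sum l - contr (lform^~ x) minors_sum l.
Proof.
rewrite /minors_sum /= /vsum mulr_suml.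
have -> : contr (lform^~ x) (ext (@eps N)) l
    = \sum_u x 0 u * ext (contr (fun c => 1 + osg c u) (@eps N)) l.
  transitivity (\sum_u x 0 u * contr (fun y => \sum_c y 0 c * (1 + osg c u)) (ext (@eps N)) l).
    elim: l (ext _) => [|y l IHl] g /=; first by rewrite big1 // => i _; rewrite mulr0.
    rewrite IHl /lform exchange_big /= mulr_suml -sumrB; apply: eq_bigr => u _.
    rewrite mulrBr mulrA; congr (_ * _ - _); rewrite mulr_sumr; apply: eq_bigr => c _.
    by ring.
  by apply: eq_bigr => u _; rewrite ext_contr.
rewrite -sumrB; apply: eq_bigr => u _; rewrite -mulrBr; congr (_ * _).
by rewrite -extN -extD; apply: eq_ext => f; exact: eps_cons.
Qed.

Lemma lform_sym x y : lform x y + lform y x = (vsum x * vsum y) *+ 2.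
Proof.
rewrite {2}/lform exchange_big /lform -big_split /= /vsum mulr_suml -sumrMnl.
apply: eq_bigr => c _; rewrite -big_split mulr_sumr -sumrMnl; apply: eq_bigr => d _ /=.
by rewrite [osg d c]osgC mulr2n; ring.
Qed.

Lemma lform_suml (I : finType) (a : I -> int) (X : I -> 'rV_N) y :
  lform (\sum_i a i *: X i) y = \sum_i a i * lform (X i) y.
Proof.
rewrite /lform; under [RHS]eq_bigr do rewrite mulr_sumr.
rewrite [RHS]exchange_big; apply: eq_bigr => c _.
under [RHS]eq_bigr do rewrite mulr_sumr.
rewrite [RHS]exchange_big; apply: eq_bigr => d _.
rewrite summxE 2!mulr_suml; apply: eq_bigr => i _.
by rewrite mxE; ring.
Qed.

Lemma lform_sumr (I : finType) (a : I -> int) (X : I -> 'rV_N) y :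
  lform y (\sum_i a i *: X i) = \sum_i a i * lform y (X i).
Proof.
rewrite /lform; under [RHS]eq_bigr do rewrite mulr_sumr.
rewrite [RHS]exchange_big; apply: eq_bigr => c _.
under [RHS]eq_bigr do rewrite mulr_sumr.
rewrite [RHS]exchange_big; apply: eq_bigr => d _.
rewrite summxE mulr_sumr mulr_suml; apply: eq_bigr => i _.
by rewrite mxE; ring.
Qed.

Definition lform_mx n l : 'M[int]_n := \matrix_(i, j) lform (nth 0 l i) (nth 0 l j).

Lemma minors_sum_dup i l : (i < size l)%N -> minors_sum (nth 0 l i :: l) = 0.
Proof. by move=> il; apply: (altmul_dup_mem (l1 := [::]) altmul_minors_sum); apply: mem_nth. Qed.

Lemma minors_sum_rem_at i l : (i < size l)%N ->
  minors_sum l = (-1) ^+ i * minors_sum (nth 0 l i :: rem_at i l).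
Proof.
move=> il; rewrite -{1}(cat_take_drop i l) (drop_nth 0 il) altmul_move1; last exact: altmul_minors_sum.
by rewrite size_take il.
Qed.

Lemma vsum_sum (I : finType) (a : I -> int) (X : I -> 'rV_N) :
  vsum (\sum_i a i *: X i) = \sum_i a i * vsum (X i).
Proof.
rewrite /vsum; under [RHS]eq_bigr do rewrite mulr_sumr.
rewrite [RHS]exchange_big; apply: eq_bigr => c _; rewrite summxE; apply: eq_bigr => i _.
by rewrite mxE.
Qed.

Lemma minors_sum_suml (I : finType) (a : I -> int) (X : I -> 'rV_N) l :
  minors_sum ((\sum_i a i *: X i) :: l) = \sum_i a i * minors_sum (X i :: l).
Proof.
rewrite /minors_sum /=; under [RHS]eq_bigr do rewrite mulr_sumr.
rewrite [RHS]exchange_big; apply: eq_bigr => c _; rewrite summxE mulr_suml.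
by apply: eq_bigr => i _; rewrite mxE mulrA.
Qed.

(** Entry [i] is the expansion by [minors_sum_cons] of the rows [l] with a second copy of row [i] in
    front, which has minor sum 0. *)
Lemma minors_sum_lform_mx n l : size l = n ->
  (\row_j ((-1) ^+ j * minors_sum (rem_at j l))) *m lform_mx n l
  = minors_sum l *: \row_(j < n) vsum (nth 0 l j).
Proof.
move=> sl; apply/rowP => i; rewrite !mxE.
have := minors_sum_dup (i := i) (l := l); rewrite sl ltn_ord => /(_ isT).
rewrite minors_sum_cons (contrE _ 0) sl => /eqP; rewrite subr_eq0 mulrC => /eqP ->.
by apply: eq_bigr => j _; rewrite !mxE; ring.
Qed.

(** A quadratic form sees only the symmetric part of its matrix, which has rank one by
    [lform_sym]. *)
Lemma lform_mx_quad n l (w : 'rV_n) :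
  (w *m lform_mx n l *m w^T) 0 0 = ((\sum_i w 0 i * vsum (nth 0 l i))) ^+ 2.
Proof.
have -> : (w *m lform_mx n l *m w^T) 0 0
    = lform (\sum_i w 0 i *: nth 0 l i) (\sum_i w 0 i *: nth 0 l i).
  rewrite lform_sumr mxE; apply: eq_bigr => j _; rewrite lform_suml !mxE mulrC.
  by congr (_ * _); apply: eq_bigr => i _; rewrite mxE.
rewrite -vsum_sum; have := lform_sym (\sum_i w 0 i *: nth 0 l i) (\sum_i w 0 i *: nth 0 l i).
by rewrite expr2; move: (lform _ _) (_ * _) => x y; lia.
Qed.

(** The key identity det (P L P^T) = S^2, by induction on the number of rows; the singular case is
    treated apart because the other one divides by the determinant. *)
Lemma det_lform_mx n l : size l = n -> all (fun x => vsum x != 0) l ->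
  \det (lform_mx n l) = minors_sum l ^+ 2.
Proof.
elim: n l => [|n IHn] l sl vl.
  by rewrite det_mx00 (size0nil sl) /minors_sum /= expr1n.
set E := lform_mx _ _; set S := minors_sum l.
pose s : 'rV_n.+1 := \row_j ((-1) ^+ j * minors_sum (rem_at j l)).
pose v : 'rV_n.+1 := \row_(j < n.+1) vsum (nth 0 l j).
have sE : s *m E = S *: v by apply: minors_sum_lform_mx.
have jl (j : 'I_n.+1) : (j < size l)%N by rewrite sl.
have [/eqP d0|d0] := boolP (\det E == 0).
  rewrite d0; suff -> : S = 0 by rewrite expr0n.
  (* A kernel vector [w] gives a combination [x] of the rows that [lform] pairs to 0 with each row,
     hence with row sum 0 by [lform_mx_quad]. So the minors of [x] with the rows other than the
     [i]-th sum to 0, while by linearity this sum is [w 0 i] times [S] up to sign. *)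
  have /det0P[w nzw wE] : \det E^T == 0 by rewrite det_tr d0.
  have [i wi] : exists i, w 0 i != 0.
    apply/existsP; apply: contraR nzw => /existsPn w0; apply/eqP/rowP => i.
    by rewrite mxE; apply/eqP; move: (w0 i); rewrite negbK.
  pose x := \sum_i w 0 i *: nth 0 l i.
  have Ex j : (j < size l)%N -> lform (nth 0 l j) x = 0.
    rewrite sl => jn; have := congr1 (fun M : 'rV_n.+1 => M 0 (Ordinal jn)) wE.
    rewrite !mxE => <-; rewrite lform_sumr; apply: eq_bigr => k _.
    by rewrite !mxE.
  have vx : vsum x = 0.
    apply/eqP; rewrite -sqrf_eq0 /x vsum_sum -lform_mx_quad -mulmxA.
    suff -> : lform_mx n.+1 l *m w^T = 0 by rewrite mulmx0 mxE.
    by rewrite -[_ *m _]trmxK trmx_mul trmxK wE trmx0.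
  have : minors_sum (x :: rem_at i l) = 0.
    rewrite minors_sum_cons vx mul0r (contrE _ 0) big1 ?subr0 // => j _.
    rewrite nth_rem_at ?sl // Ex ?mul0r ?mulr0 // sl.
    have jn : (j < n)%N by apply: leq_trans (ltn_ord j) _; rewrite size_rem_at ?sl.
    by apply: leq_ltn_trans (leq_add (leq_b1 _) (leqnn j)) _.
  rewrite /x minors_sum_suml (bigD1 i) //= big1 ?addr0; last first.
    move=> j ji; rewrite (altmul_dup_mem (l1 := [::]) (@altmul_minors_sum)) ?mulr0 //=.
    have [k kj] : exists k : 'I_n, j = lift i k by case: (unliftP i j) ji => [k ->|->]; [exists k|rewrite eqxx].
    by rewrite kj -(nth_rem_at 0 _ (jl i)) mem_nth // size_rem_at ?sl /=.
  move/eqP; rewrite mulf_eq0 (negPf wi) /= => /eqP Si.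
  by rewrite /S (minors_sum_rem_at (jl i)) Si mulr0.
(* Multiplying [sE] by the adjugate gives det E s = S y. The quadratic form at column [j] of the
   adjugate gives det E s_j^2 = y_j^2, since its diagonal entry is s_j^2 by induction. Together they
   give the claim multiplied by det E s_j^2. *)
pose y := v *m \adj E.
have ds j : \det E * s 0 j = S * y 0 j.
  have := congr1 (fun M : 'rV_n.+1 => (M *m \adj E) 0 j) sE.
  by rewrite -mulmxA mul_mx_adj mul_mx_scalar -scalemxAl !mxE.
have dy j : \det E * s 0 j ^+ 2 = y 0 j ^+ 2.
  pose w : 'rV_n.+1 := (col j (\adj E))^T.
  have := lform_mx_quad l w; rewrite -/E -mulmxA trmxK colE.
  rewrite [E *m _]mulmxA mul_mx_adj mul_scalar_mx -scalemxAr mxE.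
  have -> : (w *m delta_mx j (0 : 'I_1)) 0 0 = \adj E j j by rewrite -colE !mxE.
  have -> : \sum_i w 0 i * vsum (nth 0 l i) = y 0 j.
    by rewrite /y mxE; apply: eq_bigr => i _; rewrite !mxE mulrC.
  (* The diagonal cofactor has sign (-1)^(2j) and is the determinant for [l] without its entry
     [j]. *)
  move<-; congr (_ * _); rewrite [s]lock mxE /cofactor -lock addnn -signr_odd odd_double mul1r.
  rewrite /s mxE exprMn sqrr_sign mul1r -IHn ?size_rem_at ?sl //; last first.
    apply/allP => z; rewrite /rem_at mem_cat => zl; apply: (allP vl).
    by case/orP: zl => [/mem_take|/mem_drop].
  congr (\det _); apply/matrixP => i k; rewrite !mxE !nth_rem_at ?sl //.
(* If [s] vanished then so would [y], hence also y E = det E v, against the nonzero row sums. *)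
have [j sj] : exists j, s 0 j != 0.
  apply/existsP; apply: contraT => /existsPn s0.
  have y0 : y = 0.
    apply/rowP => j; rewrite [RHS]mxE; apply/eqP; rewrite -sqrf_eq0 -dy.
    by move: (s0 j); rewrite negbK => /eqP ->; rewrite expr0n mulr0.
  have := congr1 (fun M : 'rV_n.+1 => (M *m E) 0 0) y0.
  rewrite /y -mulmxA mul_adj_mx mul0mx mul_mx_scalar !mxE => /eqP.
  rewrite mulf_eq0 (negPf d0) /=; move: vl; case: (l) sl => // z l' _ /= /andP[/negPf ->].
  by [].
have : \det E * (\det E * s 0 j ^+ 2) = S ^+ 2 * (\det E * s 0 j ^+ 2).
  by rewrite {2}dy -exprMn -ds; ring.
by apply: mulIf; rewrite mulf_neq0 // expf_neq0.
Qed.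

End Ext.

(** * Determinants of centrally symmetric systems *)

Lemma altmul_of_dup (V : zmodType) (F : seq V -> int) :
  (forall l1 u v l2, F (l1 ++ (u + v) :: l2) = F (l1 ++ u :: l2) + F (l1 ++ v :: l2)) ->
  (forall l1 u l2, F (l1 ++ u :: u :: l2) = 0) -> altmul F.
Proof.
move=> aF dF; split=> // l1 u v l2; have := dF l1 (u + v) l2.
rewrite aF -!(cat_rcons _ l1) !aF !cat_rcons !dF add0r addr0 => /eqP.
by rewrite addr_eq0 => /eqP.
Qed.

Lemma altmul_sum (V : zmodType) (I : finType) (F : I -> seq V -> int) :
  (forall i, altmul (F i)) -> altmul (fun l => \sum_i F i l).
Proof.
move=> FF; split=> [l1 u v l2|l1 u v l2].
  by rewrite -big_split; apply: eq_bigr => i _; rewrite (FF i).1.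
by rewrite -sumrN; apply: eq_bigr => i _; rewrite (FF i).2.
Qed.

Lemma nth_cat_neq (T : Type) (x0 u v : T) l1 l2 b : b != size l1 ->
  nth x0 (l1 ++ u :: l2) b = nth x0 (l1 ++ v :: l2) b.
Proof.
by rewrite !nth_cat; case: ltngtP => // lb _; have := lb; rewrite -subn_gt0; case: (_ - _)%N.
Qed.

(** The value 0 for a wrong number of rows makes the determinant a function on all sequences, as
    [altmul] requires. *)
Definition det_rows (V : zmodType) m (A : 'I_m -> V -> int) (l : seq V) : int :=
  if size l == m then \det (\matrix_(i < m, j < m) A j (nth 0 l i)) else 0.

Lemma altmul_det_rows (V : zmodType) m (A : 'I_m -> V -> int) :
  (forall j u v, A j (u + v) = A j u + A j v) -> altmul (det_rows A).
Proof.
move=> aA.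
apply: altmul_of_dup => [l1 u v l2|l1 u l2]; rewrite /det_rows !size_cat /=; last first.
  case: eqP => // sm.
  have i1 : (size l1 < m)%N by rewrite -sm; lia.
  have i2 : ((size l1).+1 < m)%N by rewrite -sm; lia.
  rewrite (@determinant_alternate _ _ _ (Ordinal i1) (Ordinal i2)) //.
    by rewrite -val_eqE /= neq_ltn ltnSn.
  move=> j; rewrite !mxE !nth_cat /= ltnn subnn ltnNge leqnSn /=.
  by rewrite subSnn.
case: eqP => [sm|_]; last by rewrite addr0.
have i1 : (size l1 < m)%N by rewrite -sm -addSnnS leq_addr.
rewrite -[\det _ + _]mul1r mulrDr.
apply: (@determinant_multilinear _ _ _ _ _ (Ordinal i1)).
- by apply/rowP => j; rewrite !mxE !nth_cat /= ltnn subnn /= !mul1r aA.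
- by apply/matrixP => i j; rewrite !mxE; congr (A j _); apply: nth_cat_neq; rewrite eq_sym /= neq_bump.
- by apply/matrixP => i j; rewrite !mxE; congr (A j _); apply: nth_cat_neq; rewrite eq_sym /= neq_bump.
Qed.

Lemma det_mxsub_inj (n : nat) (s : 'I_n -> 'I_n) (A : 'M[int]_n) :
  injective s -> \det (mxsub s s A) = \det A.
Proof.
move=> s_inj; have -> : mxsub s s A = row_perm (perm s_inj) (col_perm (perm s_inj) A).
  by apply/matrixP => i j; rewrite !mxE !permE.
rewrite row_permE col_permE !det_mulmx !det_perm odd_permV mulrC -mulrA -signr_addb addbb.
by rewrite mulr1.
Qed.

(** Adding the second block row to the first and then subtracting the first block column from the
    second makes the matrix block triangular. *)
Lemma det_block_sym n (X Y : 'M[int]_n) :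
  \det (block_mx X Y Y X) = \det (X - Y) * \det (X + Y).
Proof.
have d1 (Z : 'M[int]_n) : \det (block_mx 1%:M Z 0 1%:M : 'M_(n + n)) = 1.
  by rewrite det_ublock !det1 mulr1.
have : block_mx 1%:M 1%:M 0 1%:M *m block_mx X Y Y X *m block_mx 1%:M (- 1%:M) 0 1%:M
    = block_mx (X + Y) 0 Y (X - Y) :> 'M_(n + n).
  rewrite !mulmx_block !mul1mx !mul0mx !add0r !mulmx1 !mulmx0 !mulmxN !mulmx1 !addr0.
  by congr block_mx; rewrite addrC // [X + Y]addrC subrr.
move/(congr1 determinant); rewrite !det_mulmx !d1 mul1r mulr1 det_lblock => ->.
exact: mulrC.
Qed.

(** Cauchy-Binet summed over all maps: a map with a repeated value contributes 0, and each set of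
    columns occurs once per ordering. In the expansion of the first determinant, a permutation is
    absorbed into the map [c] and its sign into the second determinant, which leaves [n]! equal
    sums. *)
Lemma cauchy_binet_fact (n N : nat) (P Q : 'M[int]_(n, N)) :
  \sum_(c : {ffun 'I_n -> 'I_N}) \det (\matrix_(i, j) P i (c j)) * \det (\matrix_(i, j) Q i (c j))
  = n`!%:R * \det (P *m Q^T).
Proof.
have dQ (c : {ffun 'I_n -> 'I_N}) (s : 'S_n) :
    \det (\matrix_(i, j) Q i (c (s j))) = (-1) ^+ s * \det (\matrix_(i, j) Q i (c j)).
  rewrite -[s in RHS]invgK odd_permV -det_perm mulrC -det_mulmx -col_permE.
  by congr (\det _); apply/matrixP => i j; rewrite !mxE.
transitivity (\sum_(s : 'S_n) \sum_(c : {ffun 'I_n -> 'I_N})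
   (\prod_i P i (c i)) * \det (\matrix_(i, j) Q i (c j))).
  under eq_bigr do rewrite {1}/determinant mulr_suml.
  rewrite exchange_big; apply: eq_bigr => s _ /=.
  rewrite [RHS](reindex_inj (h := fun c : {ffun 'I_n -> 'I_N} => [ffun i => c (s i)])) /=; last first.
    move=> c d /ffunP e; apply/ffunP => i; have := e (s^-1%g i); rewrite !ffunE.
    by rewrite permKV.
  apply: eq_bigr => c _.
  under [in RHS]eq_bigr do rewrite ffunE.
  rewrite -mulrA mulrCA -dQ; under eq_bigr do rewrite mxE.
  by congr (_ * \det _); apply/matrixP => i j; rewrite !mxE ffunE.
rewrite sumr_const card_Sn mulr_natl; congr (_ *+ _).
under eq_bigr do rewrite -det_tr /determinant mulr_sumr.
rewrite exchange_big /determinant; apply: eq_bigr => s _ /=.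
under [in RHS]eq_bigr do rewrite mxE.
rewrite bigA_distr_bigA /= mulr_sumr; apply: eq_bigr => c _.
rewrite mulrCA -big_split; congr (_ * _); apply: eq_bigr => i _; rewrite !mxE //=.
Qed.

(** * Sums of determinants over symmetric sets of end points *)

Section PairDet.
Variables n N : nat.
Local Notation V := ('rV[int]_N * 'rV[int]_N)%type.
Implicit Types (l : seq V) (c : {ffun 'I_n -> 'I_N}).

Definition twist (x : V) : V := (x.2, x.1).

Lemma half_ord_subproof (j : 'I_(n + n)) : (j./2 < n)%N.
Proof. by have := ltn_ord j; lia. Qed.
Definition half_ord (j : 'I_(n + n)) : 'I_n := Ordinal (half_ord_subproof j).

Definition pair_coef c (j : 'I_(n + n)) (x : V) : int :=
  (if odd j then x.2 else x.1) 0 (c (half_ord j)).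

(* Columns [2 i] and [2 i + 1] of the determinants are the columns [c i] of the two halves of the
   rows; summing over all maps [c] instead of subsets counts each subset [n`!] times. *)
Definition pair_sum l : int := \sum_c det_rows (pair_coef c) l.

Lemma altmul_pair_sum : altmul pair_sum.
Proof.
apply: altmul_sum => c; apply: altmul_det_rows => j u v; rewrite /pair_coef.
by case: ifP => _; rewrite mxE.
Qed.

Lemma nth_pairs l j :
  nth 0 (pairs twist l) j = if odd j then nth 0 l j./2 else twist (nth 0 l j./2).
Proof.
elim: l j => [|x l IHl] j; first by rewrite !nth_nil; case: ifP.
by case: j => [|[|j]] //=; rewrite IHl negbK.
Qed.

Lemma size_pairs l : size (pairs twist l) = (size l + size l)%N.
Proof. by elim: l => //= x l ->; rewrite addnS. Qed.

(** The place in the interleaved order of row [i] of the block order. Permuting rows and columns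
    alike keeps the determinant. *)
Definition unpair (i : 'I_(n + n)) : nat :=
  match split i with inl k => k.*2 | inr k => k.*2.+1 end.
Lemma unpair_subproof i : (unpair i < n + n)%N.
Proof. by rewrite /unpair; case: split => k; have := ltn_ord k; lia. Qed.
Definition unpair_ord i : 'I_(n + n) := Ordinal (unpair_subproof i).

Lemma unpair_inj : injective unpair_ord.
Proof.
move=> i j /(congr1 val) /=; rewrite /unpair => e; apply: (can_inj (@splitK _ _)).
move: e; case: (split i) => a; case: (split j) => b /= e.
- by rewrite (val_inj (double_inj e)).
- by have /(congr1 odd) := e; rewrite /= !odd_double.
- by have /(congr1 odd) := e; rewrite /= !odd_double.
- by rewrite (val_inj (double_inj (succn_inj e))).
Qed.

Definition diff_mx l : 'M[int]_(n, N) := \matrix_(i, j) ((nth 0 l i).2 - (nth 0 l i).1) 0 j.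
Definition add_mx l : 'M[int]_(n, N) := \matrix_(i, j) ((nth 0 l i).2 + (nth 0 l i).1) 0 j.

(** Each summand is the determinant of [[X, Y], [Y, X]] up to the reordering [unpair], hence det (X
    - Y) det (X + Y); Cauchy-Binet sums these products. *)
Lemma pair_sum_pairs l : size l = n ->
  pair_sum (pairs twist l) = n`!%:R * \det (diff_mx l *m (add_mx l)^T).
Proof.
move=> sl; rewrite -cauchy_binet_fact; apply: eq_bigr => c _.
rewrite /det_rows size_pairs sl eqxx -(det_mxsub_inj _ unpair_inj).
pose X : 'M[int]_n := \matrix_(i, j) (nth 0 l i).2 0 (c j).
pose Y : 'M[int]_n := \matrix_(i, j) (nth 0 l i).1 0 (c j).
transitivity (\det (block_mx X Y Y X)); last first.
  by rewrite det_block_sym; congr (_ * _); congr (\det _); apply/matrixP => i j; rewrite !mxE.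
congr (\det _); apply/matrixP => i j; rewrite !mxE /pair_coef nth_pairs /=.
have -> : half_ord (unpair_ord j) = match split j with inl k => k | inr k => k end.
  by apply: val_inj; rewrite /= /unpair; case: split => k /=; lia.
rewrite /unpair; case: (split i) => a; rewrite !mxE; case: (split j) => b; rewrite !mxE /=;
by rewrite ?odd_double /= ?doubleK ?uphalf_double.
Qed.

End PairDet.

(** * Rows of walk numbers *)

(* The number of [d]-step walks on the integers with total displacement [u]. *)
Fixpoint walks (d : nat) (u : int) : int :=
  if d is d'.+1 then walks d' (u - 1) + walks d' (u + 1) else (u == 0)%:R.

Lemma walks_ge0 d u : 0 <= walks d u.
Proof. by elim: d u => [|d IHd] u /=; rewrite ?ler0n // addr_ge0. Qed.

Lemma walks_far d u : d%:Z < `|u| -> walks d u = 0.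
Proof.
elim: d u => [|d IHd] u /= du; first by case: eqP du => // ->.
by rewrite !IHd ?addr0 //; lia.
Qed.

Lemma walks_odd d u : odd (d + `|u|) -> walks d u = 0.
Proof.
elim: d u => [|d IHd] u /=; first by case: eqP => // ->.
by move=> du; rewrite !IHd ?addr0 //; lia.
Qed.

Lemma walks_gt0 d (u : nat) : (u <= d)%N -> ~~ odd (d + u) -> 0 < walks d u.
Proof.
elim: d u => [|d IHd] u ud du /=; first by have -> : u = 0%N by lia.
have [u0|u0] := posnP u.
  by rewrite u0 add0r ltr_wpDl ?walks_ge0 //; apply: (IHd 1%N); lia.
have -> : u%:Z - 1 = u.-1%:Z by lia.
by rewrite ltr_wpDr ?walks_ge0 //; apply: IHd; lia.
Qed.

Section Rows.
Variables (n N : nat).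

(* Column [c] stands for the height [n + 1 + c]: the rhombus leaves only the end points of
   absolute height greater than [n]. *)
Definition wrow (d : nat) (t : int) : 'rV[int]_N := \row_c walks d ((n + 1 + c)%N%:Z - t).
(** Walks from [- t] to a positive height mirror walks from [t] to the opposite height, so the two
    components record the negative and the positive end points of a walker at [t]. *)
Definition wrow2 (d : nat) (t : int) : ('rV[int]_N * 'rV[int]_N)%type := (wrow d (- t), wrow d t).
(** By the reflection principle, for positive [t] these are the numbers of walks that avoid height
    0. *)
Definition wrow1 (d : nat) (t : int) : 'rV[int]_N := wrow d t - wrow d (- t).

Lemma wrowS d t : wrow d.+1 t = wrow d (t + 1) + wrow d (t - 1).
Proof.
apply/rowP => c; rewrite !mxE /=; congr (walks d _ + walks d _); ring.
Qed.

Lemma wrow2S d t : wrow2 d.+1 t = wrow2 d (t + 1) + wrow2 d (t - 1).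
Proof.
rewrite /wrow2 !wrowS; congr (_, _); rewrite addrC; congr (wrow d _ + wrow d _); ring.
Qed.

Lemma wrow1S d t : wrow1 d.+1 t = wrow1 d (t + 1) + wrow1 d (t - 1).
Proof.
rewrite /wrow1 !wrowS [X in _ - X]addrC !opprD addrACA.
by congr (_ + _ + (_ + _)); congr (- wrow d _); ring.
Qed.

(** No walk from such a start gets beyond absolute height [n], where the columns begin. *)
Lemma wrow_eq0 d t : `|t| + d%:Z <= n%:Z -> wrow d t = 0.
Proof. by move=> tn; apply/rowP => c; rewrite !mxE walks_far //; lia. Qed.

Lemma wrow2N d t : wrow2 d (- t) = twist (wrow2 d t).
Proof. by rewrite /wrow2 /twist /= opprK. Qed.

Lemma wrow1N d t : wrow1 d (- t) = - wrow1 d t.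
Proof. by rewrite /wrow1 opprK opprB. Qed.

Lemma wrow2_eq0 d t : `|t| + d%:Z <= n%:Z -> wrow2 d t = 0.
Proof. by move=> tn; rewrite /wrow2 !wrow_eq0 // normrN. Qed.

Lemma wrow1_eq0 d t : `|t| + d%:Z <= n%:Z -> wrow1 d t = 0.
Proof. by move=> tn; rewrite /wrow1 !wrow_eq0 ?subr0 // normrN. Qed.

Lemma wrow1_0 d : wrow1 d 0 = 0.
Proof. by rewrite /wrow1 oppr0 subrr. Qed.

Lemma wrow1E d t c : wrow1 d t 0 c =
  walks d ((n + 1 + c)%N%:Z - t) - walks d ((n + 1 + c)%N%:Z + t).
Proof. by rewrite !mxE opprK. Qed.

End Rows.

Lemma span_sub (V : zmodType) (P Q : V -> Prop) v :
  (forall u, P u -> span Q u) -> span P v -> span Q v.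
Proof.
move=> PQ; elim=> [u /PQ //||u w _ IHu _ IHw|u _ IHu].
- exact: span_zero.
- exact: span_add.
- exact: span_opp.
Qed.

(* The extreme endpoint [t + j] of a [j]-step walk from [t] is reached by one walk only, so row
   [t] at depth [d + j] is row [t + j] at depth [d] plus a combination of rows closer to [t]. *)
Lemma walk_span (V : zmodType) (phi : nat -> int -> V) (e : int) j t d :
  (forall d t, phi d.+1 t = phi d (t + 1) + phi d (t - 1)) -> `|e| = 1 ->
  span (fun u => exists2 r : nat, (r < j)%N & u = phi d (t + e * (j%:Z - (r.+1).*2%:Z)))
    (phi (d + j)%N t - phi d (t + e * j%:Z)).
Proof.
move=> phiS e1; have e2 : e = 1 \/ e = -1 by lia.
elim: j t => [|j IHj] t.
  by rewrite addn0 mulr0 addr0 subrr; apply: span_zero.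
rewrite addnS phiS.
have -> : phi (d + j)%N (t + 1) + phi (d + j)%N (t - 1)
        = phi (d + j)%N (t + e) + phi (d + j)%N (t - e).
  by case: e2 => ->; rewrite ?opprK // addrC.
have -> : phi (d + j)%N (t + e) + phi (d + j)%N (t - e) - phi d (t + e * j.+1%:Z)
   = (phi (d + j)%N (t + e) - phi d (t + e + e * j%:Z))
   + ((phi (d + j)%N (t - e) - phi d (t - e + e * j%:Z)) + phi d (t - e + e * j%:Z)).
  have -> : t + e * j.+1%:Z = t + e + e * j%:Z by rewrite intS; ring.
  by rewrite subrK addrAC.
apply: span_add; [|apply: span_add].
- apply: span_sub (IHj _) => u [r rj ->]; apply: span_mem; exists r; first exact: ltnW.
  by congr (phi d _); rewrite intS; ring.
- apply: span_sub (IHj _) => u [r rj ->]; apply: span_mem; exists r.+1 => //.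
  by congr (phi d _); case: e2 => ->; lia.
- apply: span_mem; exists 0%N => //; congr (phi d _).
  by case: e2 => ->; lia.
Qed.

(** * Row operations bringing all starting points to height 1 *)

Section Staircase.
Variables (V : zmodType) (phi : nat -> int -> V) (F : seq V -> int).
Hypothesis phiS : forall d t, phi d.+1 t = phi d (t + 1) + phi d (t - 1).
Hypothesis FF : altmul F.

(** By [walk_span], row 1 at depth [d + b.*2] is row [b.*2.+1] at depth [d] plus rows at depth [d]
    of smaller absolute height. Oddness of [phi] folds the negative heights back onto rows already
    present. *)
Lemma altmul_staircase1 d b pre post : (forall d t, phi d (- t) = - phi d t) ->
  F (pre ++ [seq phi d (i.*2.+1)%:Z | i <- iota 0 b] ++ post)
  = F (pre ++ [seq phi (d + i.*2)%N 1 | i <- iota 0 b] ++ post).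
Proof.
move=> phiN; elim: b post => // b IHb post.
rewrite -addn1 iotaD /= add0n !map_cat /= -!catA -IHb /= !catA.
rewrite -[phi (d + _)%N 1](subrK (phi d (b.*2.+1)%:Z)) addrC altmul_add_span //.
have := @walk_span _ phi 1 b.*2 1 d phiS (normr1 _).
have -> : 1 + 1 * (b.*2)%:Z = (b.*2.+1)%:Z by rewrite mul1r -intS.
apply: span_sub => u [r rb ->].
have mem (i : nat) : (i < b)%N -> span (fun u => u \in (pre ++
    [seq phi d (i.*2.+1)%:Z | i <- iota 0 b]) ++ post) (phi d (i.*2.+1)%:Z).
  move=> ib; apply: span_mem; rewrite !mem_cat; apply/orP; left; apply/orP; right.
  by apply/mapP; exists i => //; rewrite mem_iota.
have [rl|rl] := leqP b r.
  have -> : 1 + 1 * ((b.*2)%:Z - (r.+1.*2)%:Z) = - ((r - b).*2.+1)%:Z by lia.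
  by rewrite phiN; apply: span_opp; apply: mem; lia.
have -> : 1 + 1 * ((b.*2)%:Z - (r.+1.*2)%:Z) = ((b - r.+1).*2.+1)%:Z by lia.
by apply: mem; lia.
Qed.

(** The same replacement for the two heights 1 and -1 of a pair; rows of negative height are the
    twins already present. *)
Lemma altmul_staircase2 (tw : V -> V) d b pre post : (forall d t, phi d (- t) = tw (phi d t)) ->
  F (pre ++ pairs tw [seq phi d (i.*2.+1)%:Z | i <- iota 0 b] ++ post)
  = F (pre ++ pairs tw [seq phi (d + i.*2)%N 1 | i <- iota 0 b] ++ post).
Proof.
move=> phiN; elim: b post => // b IHb post.
rewrite -addn1 iotaD /= add0n !map_cat !pairs_cat /= -!catA -IHb /= !catA -!phiN.
set U := pre ++ _.
have mem (i : nat) l : (i < b)%N -> span (fun u => u \in U ++ l) (phi d (i.*2.+1)%:Z)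
   /\ span (fun u => u \in U ++ l) (phi d (- (i.*2.+1)%:Z)).
  move=> ib; split; apply: span_mem; rewrite !mem_cat; apply/orP; left; apply/orP; right;
    apply/flattenP; exists [:: tw (phi d (i.*2.+1)%:Z); phi d (i.*2.+1)%:Z];
    rewrite ?phiN ?inE ?eqxx ?orbT //;
    by rewrite -map_comp; apply/mapP; exists i => //; rewrite mem_iota.
have memz (z : int) l : odd `|z| -> `|z| < b.*2%:Z -> span (fun u => u \in U ++ l) (phi d z).
  move=> oz zb; have [z0|z0] := lerP 0 z.
    have -> : z = (`|z|./2.*2.+1)%:Z by lia.
    by have [] := mem `|z|%N./2 l; first lia.
  have -> : z = - (`|z|./2.*2.+1)%:Z by lia.
  by have [] := mem `|z|%N./2 l; first lia.
have sp (e : int) l : `|e| = 1 -> span (fun u => u \in U ++ l)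
    (phi (d + b.*2)%N e - phi d (e * (b.*2.+1)%:Z)).
  move=> e1; have := @walk_span _ phi e b.*2 e d phiS e1.
  have -> : e + e * (b.*2)%:Z = e * (b.*2.+1)%:Z by rewrite intS; ring.
  have e2 : e = 1 \/ e = -1 by lia.
  by apply: span_sub => u [r rb ->]; apply: memz; case: e2 => ->; lia.
rewrite -[phi (d + _)%N (-1)](subrK (phi d (- (b.*2.+1)%:Z))) addrC altmul_add_span //; last first.
  by have := sp (-1); rewrite mulN1r; apply.
rewrite -!(cat_rcons (phi d (- (b.*2.+1)%:Z)) U).
rewrite -[phi (d + _)%N 1](subrK (phi d (b.*2.+1)%:Z)) addrC altmul_add_span //.
rewrite cat_rcons; have := sp 1 (phi d (- (b.*2.+1)%:Z) :: post); rewrite mul1r; exact.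
Qed.
End Staircase.

(** A row of differences times L: the terms before [c] have weight 0, the one at [c] has weight 1,
    and the later ones have weight 2 and telescope. *)
Lemma sum_telescope_sign (G : nat -> int) (c M : nat) :
  \sum_(d < M) (G d - G d.+1) * (1 + (if (c < d)%N then 1 else if (d < c)%N then -1 else 0))
  = if (M <= c)%N then 0 else G c + G c.+1 - G M *+ 2.
Proof.
elim: M => [|M IHM]; first by rewrite big_ord0.
rewrite big_ord_recr /= IHM; have [Mc|cM|->] := ltngtP M c.
- by rewrite subrr mulr0.
- by rewrite !mulr2n; ring.
- by rewrite mulr2n; ring.
Qed.

(** * The key identity applied to walkers starting at height 1 *)

Section WalkRows.
Variables (n N p : nat).
(** The lower bound makes the row sum nonzero, the upper bound keeps all end points within the [N]
    columns, and the common parity makes all rows vanish on the same alternate columns. *)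
Let good d := [&& (n <= d)%N, (d < n + N)%N & odd d == odd p].

(** The reflection shifts the displacement by two; adding and subtracting the intermediate value
    gives consecutive differences, which telescope over the columns. *)
Lemma wrow1_tele d (c : 'I_N) :
  wrow1 n N d 1 0 c = (walks d (n + c)%N + walks d (n + c).+1)
                      - (walks d (n + c.+1)%N + walks d (n + c.+1).+1).
Proof.
rewrite wrow1E.
have -> : (n + 1 + c)%N%:Z - 1 = (n + c)%N by lia.
have -> : (n + 1 + c)%N%:Z + 1 = (n + c.+1).+1 by lia.
by rewrite addnS; ring.
Qed.

Lemma vsum_wrow1 d : good d -> vsum (wrow1 n N d 1) != 0.
Proof.
case/and3P => nd dN _; suff -> : vsum (wrow1 n N d 1) = walks d n + walks d n.+1.
  have [o|e] := boolP (odd (d + n)).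
    by rewrite gt_eqF // ltr_wpDl ?walks_ge0 // walks_gt0 //; lia.
  by rewrite gt_eqF // ltr_wpDr ?walks_ge0 // walks_gt0.
rewrite /vsum; under eq_bigr do rewrite wrow1_tele.
pose G c := - (walks d (n + c)%N + walks d (n + c).+1).
rewrite -(big_mkord xpredT (fun c => (walks d (n + c)%N + walks d (n + c).+1)
  - (walks d (n + c.+1)%N + walks d (n + c.+1).+1))).
rewrite (eq_bigr (fun c => G c.+1 - G c)); last by move=> c _; rewrite /G; ring.
rewrite telescope_sumr // /G addn0 [walks d (n + N)%N]walks_far ?[walks d (n + N).+1]walks_far; lia.
Qed.

(** The relation (X + Y)^T = L P^T on the columns of the right parity: the right side counts the
    walks from 1 and from -1 to height [n + 1 + c]. *)
Lemma wrow1_lform d (c : 'I_N) : (d < n + N)%N -> odd (d + (n + c).+1) ->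
  \sum_e (wrow1 n N d 1) 0 e * (1 + osg c e) = walks d (n + c)%N + walks d (n + c).+2.
Proof.
move=> dN oc; under eq_bigr do rewrite wrow1_tele.
rewrite (sum_telescope_sign (fun c => walks d (n + c)%N + walks d (n + c).+1)).
rewrite leqNgt ltn_ord /= addnS.
rewrite [walks d (n + N)%N]walks_far ?[walks d (n + N).+1]walks_far; try lia.
by rewrite [walks d (n + c).+1]walks_odd ?addr0 ?mul0rn ?subr0 ?add0r //; lia.
Qed.

Lemma pair_sum_minors (ds : seq nat) : all good ds ->
  pair_sum (size ds) (pairs (@twist N) [seq wrow2 n N d 1 | d <- ds])
  = (size ds)`!%:R * minors_sum [seq wrow1 n N d 1 | d <- ds] ^+ 2.
Proof.
move=> /allP gds; rewrite pair_sum_pairs ?size_map // -(@det_lform_mx _ (size ds)) ?size_map //; last first.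
  by apply/allP => x /mapP[d /gds gd ->]; apply: vsum_wrow1.
congr (_ * \det _); apply/matrixP => i j; rewrite mxE [RHS]mxE /lform; apply: eq_bigr => c _.
have /gds /and3P[_ iN oi] := mem_nth 0%N (ltn_ord i).
have /gds /and3P[_ jN oj] := mem_nth 0%N (ltn_ord j).
rewrite !(nth_map 0%N) //; set di := nth _ _ i in iN oi *; set dj := nth _ _ j in jN oj *.
have -> : diff_mx _ [seq wrow2 n N d 1 | d <- ds] i c = wrow1 n N di 1 0 c.
  by rewrite mxE (nth_map 0%N).
have -> : (add_mx _ [seq wrow2 n N d 1 | d <- ds])^T c j = (wrow n N dj 1 + wrow n N dj (- 1)) 0 c.
  by rewrite !mxE (nth_map 0%N) // !mxE.
under eq_bigr do rewrite -mulrA; rewrite -mulr_sumr.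
(* On columns of the wrong parity the entry of X - Y is 0, so only the other columns have to
   agree. *)
have [oc|ec] := boolP (odd (di + (n + c))).
  by rewrite wrow1E !walks_odd ?subr0 ?mul0r //; lia.
rewrite wrow1_lform //; last by lia.
congr (_ * _); rewrite !mxE; congr (walks dj _ + walks dj _); lia.
Qed.

End WalkRows.

(** * Counting non-intersecting walkers *)

(** A pair is the height of a walker with the direction of its next step, [true] meaning up. *)
Definition step (d : int * bool) : int := if d.2 then d.1 + 1 else d.1 - 1.
Definition mv (c : seq (int * bool)) : seq int := [seq step d | d <- c].

Fixpoint cols (h : seq int) : seq (seq (int * bool)) :=
  if h is x :: h' then
    [seq (x, true) :: c | c <- cols h'] ++ [seq (x, false) :: c | c <- cols h']
  else [:: [::]].

Lemma mem_cols h c : (c \in cols h) = (unzip1 c == h).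
Proof.
elim: h c => [|x h IHh] c /=; first by rewrite inE; case: c.
have memcons b : ((c \in [seq (x, b) :: c | c <- cols h])
    = if c is d :: c' then (d == (x, b)) && (unzip1 c' == h) else false).
  apply/mapP/idP => [[c' c'h ->]|]; first by rewrite eqxx -IHh.
  by case: c => // d c' /andP[/eqP-> c'h]; exists c'; rewrite ?IHh.
rewrite mem_cat !memcons; case: c {memcons} => // -[y b] c /=.
by rewrite eqseq_cons !xpair_eqE -andb_orl -andb_orr; case: b; rewrite ?orbT ?andbT.
Qed.

Lemma uniq_cols h : uniq (cols h).
Proof.
have inj b x : injective (cons (x, b) : seq (int * bool) -> _) by move=> ? ? [].
elim: h => //= x h IHh; rewrite cat_uniq !map_inj_uniq // IHh /= andbT.
by apply/hasPn => c /mapP[c' _ ->]; apply/mapP => -[].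
Qed.

Section Counting.
Variables (ok : nat -> seq int -> bool) (inj : nat -> seq int -> seq int).
Variable final : seq int -> bool.

(* The number of ways to continue from the sorted heights [h] on line [k] for [j] more lines:
   [ok] tests the heights reached on a line, [inj] adds the walkers emitted there. *)
Fixpoint pcount (k j : nat) (h : seq int) : nat :=
  if j is j'.+1 then
    \sum_(c <- cols h) (if ok k.+1 (mv c) then pcount k.+1 j' (inj k.+1 (mv c)) else 0)
  else final h.

Variables (V : zmodType) (F : seq V -> int) (phi : nat -> int -> V) (fx : nat -> seq V).
Variables (A : nat) (c0 : int) (Inv : nat -> seq int -> Prop).
Hypothesis FF : altmul F.
Hypothesis phiS : forall k t, (k < A)%N -> phi k t = phi k.+1 (t + 1) + phi k.+1 (t - 1).

Lemma sum_cols_altmul k h pre : (k < A)%N ->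
  \sum_(c <- cols h) F (pre ++ [seq phi k.+1 t | t <- mv c]) = F (pre ++ [seq phi k t | t <- h]).
Proof.
move=> kA; elim: h pre => [|x h IHh] pre /=; first by rewrite big_seq1.
rewrite phiS // FF.1 big_cat !big_map /=.
congr (_ + _); rewrite -cat_rcons -IHh; apply: eq_bigr => c _; by rewrite cat_rcons.
Qed.

Hypothesis Hstep : forall k h c, (k < A)%N -> Inv k h -> unzip1 c = h ->
  if ok k.+1 (mv c) then
    Inv k.+1 (inj k.+1 (mv c)) /\
    F (fx k.+1 ++ [seq phi k.+1 t | t <- inj k.+1 (mv c)]) = F (fx k ++ [seq phi k.+1 t | t <- mv c])
  else F (fx k ++ [seq phi k.+1 t | t <- mv c]) = 0.
Hypothesis Hfin : forall h, Inv A h -> F (fx A ++ [seq phi A t | t <- h]) = c0 * (final h)%:R.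

(** The non-intersecting path determinant, one lattice line at a time: additivity expands [F] over
    all choices of steps, and [Hstep] makes the forbidden choices vanish. The rows [fx k] stand for
    the walkers emitted after line [k]. *)
Lemma pcount_altmul k j h : (k + j)%N = A -> Inv k h ->
  F (fx k ++ [seq phi k t | t <- h]) = c0 * (pcount k j h)%:R.
Proof.
elim: j k h => [|j IHj] k h /= kj Ih.
  by move: kj Ih; rewrite addn0 => -> Ih; apply: Hfin.
have kA : (k < A)%N by lia.
rewrite -sum_cols_altmul // natr_sum mulr_sumr !big_seq; apply: eq_bigr => c.
rewrite mem_cols => /eqP ch; have := Hstep kA Ih ch; case: ifP => _ //; last by move->; rewrite mulr0.
by case=> I' <-; apply: IHj => //; lia.
Qed.

End Counting.

Lemma altmul_nuniq (V : zmodType) (F : seq V -> int) (T : eqType) (phi : T -> V) pre h :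
  altmul F -> ~~ uniq h -> F (pre ++ map phi h) = 0.
Proof.
move=> FF; elim: h pre => //= x h IHh pre; rewrite negb_and negbK => /orP[xh|nu].
  by apply: altmul_dup_mem => //; rewrite mem_cat map_f ?orbT.
by rewrite -cat_rcons IHh.
Qed.

Lemma altmul_span_map (V : zmodType) (F : seq V -> int) (T : eqType) (phi : T -> V) pre h m :
  altmul F -> m \in h -> span (fun u => u \in pre) (phi m) -> F (pre ++ map phi h) = 0.
Proof.
move=> FF /splitPr[p q]; rewrite map_cat /= catA => sp; apply: altmul_span => //.
by apply: span_sub sp => u up; apply: span_mem; rewrite !mem_cat up.
Qed.

(** Distinct heights of equal parity differ by at least 2, so one step can make neighbours meet but
    not cross. *)
Lemma mv_sorted_le (k : nat) c : sorted <%R (unzip1 c) ->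
  all (fun t : int => odd (k + `|t|)) (unzip1 c) -> sorted <=%R (mv c).
Proof.
elim: c => // -[x b] [|[y b'] c] IHc //= /andP[xy s] /andP[ox oy].
apply/andP; split; last exact: IHc.
by case/andP: oy => oy _; rewrite /step /=; clear -xy ox oy; case: b b' => -[]; lia.
Qed.

Lemma mv_parity (k : nat) c :
  all (fun t : int => odd (k + `|t|)) (unzip1 c) -> all (fun t : int => odd (k.+1 + `|t|)) (mv c).
Proof.
move=> /allP oc; apply/allP => t /mapP[[x b] xc ->].
by have := oc x (map_f fst xc); rewrite /step /=; case: (b); lia.
Qed.

Lemma mv_bound (K : int) c :
  all (fun t : int => `|t| + 1 <= K) (unzip1 c) -> all (fun t : int => `|t| <= K) (mv c).
Proof.
move=> /allP oc; apply/allP => t /mapP[[x b] xc ->].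
by have := oc x (map_f fst xc); rewrite /step /=; case: (b); lia.
Qed.

Lemma lt_sorted_cat (h1 h2 : seq int) : sorted <%R h1 -> sorted <%R h2 ->
  (forall x y, x \in h1 -> y \in h2 -> x < y) -> sorted <%R (h1 ++ h2).
Proof.
move=> s1 s2 h12; rewrite sorted_pairwise; last exact: lt_trans.
rewrite pairwise_cat -!(sorted_pairwise lt_trans) s1 s2 !andbT.
by apply/allrelP => x y; apply: h12.
Qed.

Lemma filter_neg_pos (h : seq int) : sorted <%R h -> 0 \notin h ->
  [seq t <- h | t < 0] ++ [seq t <- h | 0 < t] = h.
Proof.
move=> sh h0; apply: lt_sorted_eq => // [|t].
  apply: lt_sorted_cat; try exact: (sorted_filter lt_trans).
  by move=> x y; rewrite !mem_filter => /andP[x0 _] /andP[y0 _]; apply: lt_trans y0.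
rewrite mem_cat !mem_filter -andb_orl; case: (ltgtP t 0) => //= t0.
by rewrite t0 (negPf h0).
Qed.

Lemma lt_sorted_sym (h : seq int) : sorted <%R h -> 0 \notin h ->
  all (fun t => - t \in h) h ->
  h = rev (map -%R [seq t <- h | 0 < t]) ++ [seq t <- h | 0 < t].
Proof.
move=> sh h0 /allP symh; apply: lt_sorted_eq => // [|t].
  have sp : sorted <%R [seq t <- h | 0 < t] by apply: (sorted_filter lt_trans).
  apply: lt_sorted_cat => //.
    rewrite rev_sorted sorted_map; apply: sub_sorted sp => x y /=; by rewrite ltrN2.
  move=> x y; rewrite mem_rev => /mapP[z]; rewrite !mem_filter => /andP[z0 _] -> /andP[y0 _].
  by apply: lt_trans y0; rewrite oppr_lt0.
rewrite mem_cat mem_rev !mem_filter.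
have -> : (t \in [seq - x | x <- h & 0 < x]) = (t < 0) && (t \in h).
  apply/mapP/andP => [[x]|[t0 th]]; rewrite ?mem_filter.
    by case/andP => x0 xh ->; rewrite oppr_lt0 x0 symh.
  by exists (- t); rewrite ?opprK // mem_filter oppr_gt0 t0 symh.
rewrite -andb_orl; case: (ltgtP t 0) => //= t0.
by rewrite t0 (negPf h0).
Qed.

Lemma ext_delta N (g : seq 'I_N -> int) cs : ext g [seq delta_mx 0 c | c <- cs] = g cs.
Proof.
elim: cs g => //= c cs IHc g; rewrite (bigD1 c) //= big1 => [|d dc]; rewrite !mxE ?eqxx /=.
  by rewrite addr0 mul1r IHc.
by rewrite (negPf dc) mul0r.
Qed.

(** The partner of column [j] in [pair_sum]: same absolute end height, opposite sign. *)
Lemma swap_ord_lt m (j : 'I_(m + m)) : ((if odd j then j.-1 else j.+1) < m + m)%N.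
Proof. by have := ltn_ord j; move: (nat_of_ord j) => {}j; case: (boolP (odd j)); lia. Qed.

Lemma swap_ord_half (j : nat) : (if odd j then j.-1 else j.+1)./2 = j./2.
Proof. by case: (boolP (odd j)); lia. Qed.

Lemma swap_ord_odd (j : nat) : odd (if odd j then j.-1 else j.+1) = ~~ odd j.
Proof. by case: (boolP (odd j)); lia. Qed.

(** * Walkers in the left half of the region *)

Section Process.
Variables (A B n : nat) (ks : seq nat).

(* Line [k] carries the vertical side of a removed left-pointing triangle. *)
Definition hole_line (k : nat) : bool := ~~ odd k && (k./2 \in ks).
Definition half_hole (k : nat) (m : int) : bool := (hole_line k.+2 && (m == 0)) || (hole_line k.+1 && (`|m| <= 1)).
(* Membership of the unit triangle [(k, m)], for [k < A], in the region. *)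
Definition half_reg (k : nat) (m : int) : bool :=
  [&& `|m| <= (2 * B + k)%N%:Z, ~~ half_hole k m & n%:Z < A%:Z - k%:Z + `|m|].

(** A walker reaching line [k] has just crossed a left-pointing triangle of the strip before it,
    hence [k.-1]. *)
Definition ok2 (k : nat) (h : seq int) := sorted <%R h && all (half_reg k.-1) h.
Definition inj2 (k : nat) (h : seq int) :=
  if hole_line k then [seq t <- h | t < 0] ++ [:: -1; 1] ++ [seq t <- h | 0 < t] else h.
Definition final2 (h : seq int) := all (fun t => (- t \in h) && (n%:Z < `|t|)) h.
Definition start1 : seq int := [seq (i.*2.+1)%:Z | i <- iota 0 B].
Definition start2 : seq int := rev (map -%R start1) ++ start1.
Definition count2 := pcount ok2 inj2 final2.

Definition ok1 (k : nat) (h : seq int) := sorted <%R h && all (fun t => (0 < t) && half_reg k.-1 t) h.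
Definition inj1 (k : nat) (h : seq int) := if hole_line k then 1 :: h else h.
Definition final1 (h : seq int) := all (fun t => n%:Z < t) h.
Definition count1 := pcount ok1 inj1 final1.

Hypothesis hole_lineA : forall k, hole_line k -> (2 <= k)%N && (k + n <= A)%N.

(** Listed from right to left, so that the next emitted rows stand last among the fixed ones, next
    to the present walkers. *)
Definition inj_lines (k : nat) : seq nat := [seq j <- rev (iota k.+1 (A - k)) | hole_line j].

Lemma inj_linesS k : (k < A)%N ->
  inj_lines k = inj_lines k.+1 ++ (if hole_line k.+1 then [:: k.+1] else [::]).
Proof.
move=> kA; rewrite /inj_lines; have -> : (A - k = (A - k.+1).+1)%N by lia.
by rewrite /= rev_cons filter_rcons; case: ifP => _; rewrite ?cats1 ?cats0.
Qed.

Lemma inj_linesA : inj_lines A = [::].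
Proof. by rewrite /inj_lines subnn. Qed.

(** End points on the axis have absolute height below [2 * B + A], so these columns contain all
    those beyond the rhombus. *)
Let N := (A + 2 * B).+1.
Let nn := (B + size (inj_lines 0))%N.
Let phi2 (k : nat) := wrow2 n N (A - k)%N.
Let phi1 (k : nat) := wrow1 n N (A - k)%N.
Let fx2 k := pairs (@twist N) [seq phi2 j 1 | j <- inj_lines k].
Let fx1 k := [seq phi1 j 1 | j <- inj_lines k].

(** The last clause counts present and future walkers; it yields [nn.*2] rows at the axis, the size
    that [pair_sum] expects. *)
Definition Inv2 (k : nat) (h : seq int) : Prop :=
  [/\ sorted <%R h, all (fun t : int => odd (k + `|t|)) h,
      all (fun t : int => `|t| + 1 <= (2 * B + k)%N%:Z) h
    & (size h + (size (inj_lines k)).*2 = nn.*2)%N].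

Definition Inv1 (k : nat) (h : seq int) : Prop :=
  [/\ sorted <%R h, all (fun t : int => odd (k + `|t|)) h,
      all (fun t : int => `|t| + 1 <= (2 * B + k)%N%:Z) h & all (fun t => 0 < t) h].

Lemma fx2S k : (k < A)%N ->
  fx2 k = fx2 k.+1 ++ (if hole_line k.+1 then [:: phi2 k.+1 (-1); phi2 k.+1 1] else [::]).
Proof.
by move=> kA; rewrite /fx2 inj_linesS // map_cat pairs_cat; case: ifP => _ //=; rewrite -wrow2N.
Qed.

Lemma fx1S k : (k < A)%N -> fx1 k = fx1 k.+1 ++ (if hole_line k.+1 then [:: phi1 k.+1 1] else [::]).
Proof. by move=> kA; rewrite /fx1 inj_linesS // map_cat; case: ifP. Qed.

Lemma phi2S k t : (k < A)%N -> phi2 k t = phi2 k.+1 (t + 1) + phi2 k.+1 (t - 1).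
Proof. by move=> kA; rewrite /phi2 -wrow2S; congr (wrow2 _ _ _ _); lia. Qed.

Lemma phi1S k t : (k < A)%N -> phi1 k t = phi1 k.+1 (t + 1) + phi1 k.+1 (t - 1).
Proof. by move=> kA; rewrite /phi1 -wrow1S; congr (wrow1 _ _ _ _); lia. Qed.

(** Three ways to leave the region: at the tip of a hole the row is the sum of the two rows emitted
    one line later, at its vertical side the row is one of the emitted ones, and inside the rhombus
    the walker cannot get out, so that the row is 0. *)
Lemma bad_span2 k (m : int) : (k < A)%N -> odd (k.+1 + `|m|) -> `|m| <= (2 * B + k)%N%:Z ->
  ~~ half_reg k m -> span (fun u => u \in fx2 k) (phi2 k.+1 m).
Proof.
move=> kA om bm; rewrite /half_reg bm /= negb_and negbK -leNgt => /orP[/orP[]/andP[hk]|bad].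
- move/eqP=> ->; have /andP[_ k2A] := hole_lineA hk.
  have k1A : (k.+1 < A)%N by lia.
  rewrite phi2S // add0r sub0r fx2S // fx2S // hk.
  by apply: span_add; apply: span_mem; rewrite !mem_cat !inE eqxx ?orbT.
- move=> m1; rewrite fx2S // hk.
  have [->|->] : m = 1 \/ m = -1 by move: hk => /andP[ok _]; lia.
    by apply: span_mem; rewrite mem_cat !inE eqxx !orbT.
  by apply: span_mem; rewrite mem_cat !inE eqxx !orbT.
- by rewrite /phi2 wrow2_eq0; [apply: span_zero | lia].
Qed.

Lemma bad_span1 k (m : int) : (k < A)%N -> odd (k.+1 + `|m|) -> `|m| <= (2 * B + k)%N%:Z -> 0 <= m ->
  ~~ ((0 < m) && half_reg k m) -> span (fun u => u \in fx1 k) (phi1 k.+1 m).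
Proof.
move=> kA om bm m0; case: (ltrP 0 m) => /= [mp|mn _]; last first.
  have -> : m = 0 by lia.
  by rewrite /phi1 wrow1_0; apply: span_zero.
rewrite /half_reg bm /= negb_and negbK -leNgt => /orP[/orP[]/andP[hk]|bad].
- by move/eqP=> m00; rewrite m00 ltxx in mp.
- move=> m1; rewrite fx1S // hk; have -> : m = 1 by lia.
  by apply: span_mem; rewrite mem_cat !inE eqxx !orbT.
- by rewrite /phi1 wrow1_eq0; [apply: span_zero | lia].
Qed.

Lemma step2 k h c : (k < A)%N -> Inv2 k h -> unzip1 c = h ->
  if ok2 k.+1 (mv c) then
    Inv2 k.+1 (inj2 k.+1 (mv c)) /\
    pair_sum nn (fx2 k.+1 ++ [seq phi2 k.+1 t | t <- inj2 k.+1 (mv c)])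
      = pair_sum nn (fx2 k ++ [seq phi2 k.+1 t | t <- mv c])
  else pair_sum nn (fx2 k ++ [seq phi2 k.+1 t | t <- mv c]) = 0.
Proof.
move=> kA [sh ph bh szh] ch; rewrite -ch in sh ph bh szh.
have FF := @altmul_pair_sum nn N.
have sle := mv_sorted_le sh ph; have pm := mv_parity ph; have bm := mv_bound bh.
have szm : size (mv c) = size (unzip1 c) by rewrite !size_map.
case: ifPn => [/andP[slt rg]|]; last first.
  rewrite /ok2 negb_and => /orP[ns|/allPn[m mm nr]].
    by apply: altmul_nuniq => //; move: ns; rewrite lt_sorted_uniq_le sle andbT.
  apply: (altmul_span_map FF mm).
  exact: bad_span2 kA (allP pm _ mm) (allP bm _ mm) nr.
have bm' : all (fun t : int => `|t| + 1 <= (2 * B + k.+1)%N%:Z) (mv c).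
  by apply/allP => t /(allP bm); clear; lia.
rewrite (fx2S kA) /inj2; case: (boolP (hole_line k.+1)) => hk; last first.
  by rewrite cats0; split=> //; split=> //; rewrite szm -szh (inj_linesS kA) (negPf hk) cats0.
have far t : t \in mv c -> 1 < `|t|.
  by move/(allP rg) => /and3P[_]; rewrite /half_hole negb_or hk /= -ltNge => /andP[].
have h0 : 0 \notin mv c by apply/negP => /far.
have np := filter_neg_pos slt h0.
split; last first.
  (* The emitted pair enters between the negative and the positive heights, past the former as a
     block and so without a sign. *)
  rewrite -{3}np !map_cat -!catA /=.
  exact: (altmul_move2 _ _ _ _ (altmul_cat (fx2 k.+1) FF)).
have neg x : x \in [seq t <- mv c | t < 0] -> x < -1.
  by rewrite mem_filter => /andP[x0 /far x1]; clear -x0 x1; lia.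
have pos x : x \in [seq t <- mv c | 0 < t] -> 1 < x.
  by rewrite mem_filter => /andP[x0 /far x1]; clear -x0 x1; lia.
have k1 : (2 <= k.+1)%N by case/andP: (hole_lineA hk).
split.
- apply: lt_sorted_cat; first exact: (sorted_filter lt_trans).
    apply: (lt_sorted_cat (h1 := [:: -1; 1])) => //; first exact: (sorted_filter lt_trans).
    by move=> x y; rewrite !inE => /orP[]/eqP-> /pos; clear; lia.
  by move=> x y /neg x1; rewrite mem_cat !inE => /orP[/orP[]/eqP->|/pos]; move: x1; clear; lia.
- rewrite all_cat /= !all_filter; apply/and4P; split; try by move: hk; rewrite /hole_line; clear; lia.
    by apply/allP => t /(allP pm) pt; apply/implyP.
  by apply/allP => t /(allP pm) pt; apply/implyP.
- rewrite all_cat /= !all_filter; apply/and4P; split; try by clear -k1; lia.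
    by apply/allP => t /(allP bm') pt; apply/implyP.
  by apply/allP => t /(allP bm') pt; apply/implyP.
- by rewrite size_cat /= -szh -szm -{3}np size_cat (inj_linesS kA) hk size_cat /=; clear; lia.
Qed.

Lemma step1 k h c : (k < A)%N -> Inv1 k h -> unzip1 c = h ->
  if ok1 k.+1 (mv c) then
    Inv1 k.+1 (inj1 k.+1 (mv c)) /\
    minors_sum (fx1 k.+1 ++ [seq phi1 k.+1 t | t <- inj1 k.+1 (mv c)])
      = minors_sum (fx1 k ++ [seq phi1 k.+1 t | t <- mv c])
  else minors_sum (fx1 k ++ [seq phi1 k.+1 t | t <- mv c]) = 0.
Proof.
move=> kA [sh ph bh gh] ch; rewrite -ch in sh ph bh gh.
have FF := @altmul_minors_sum N.
have sle := mv_sorted_le sh ph; have pm := mv_parity ph; have bm := mv_bound bh.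
have ge0 t : t \in mv c -> 0 <= t.
  case/mapP => -[x b] xc ->; have := allP gh x (map_f fst xc).
  by rewrite /step /=; case: (b); clear; lia.
case: ifPn => [/andP[slt rg]|]; last first.
  rewrite /ok1 negb_and => /orP[ns|/allPn[m mm nr]].
    by apply: altmul_nuniq => //; move: ns; rewrite lt_sorted_uniq_le sle andbT.
  apply: (altmul_span_map FF mm).
  exact: bad_span1 kA (allP pm _ mm) (allP bm _ mm) (ge0 _ mm) nr.
have bm' : all (fun t : int => `|t| + 1 <= (2 * B + k.+1)%N%:Z) (mv c).
  by apply/allP => t /(allP bm); clear; lia.
have pos : all (fun t => 0 < t) (mv c) by apply/allP => t /(allP rg)/andP[].
rewrite (fx1S kA) /inj1; case: (boolP (hole_line k.+1)) => hk; last by rewrite cats0.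
split; last by rewrite -catA.
have k1 : (2 <= k.+1)%N by case/andP: (hole_lineA hk).
split=> //=.
- rewrite (path_sortedE lt_trans) slt andbT; apply/allP => t tm.
  have /andP[t0 /and3P[_]] := allP rg _ tm.
  by rewrite /half_hole negb_or hk /= -ltNge => /andP[_ t1] _; clear -t0 t1; lia.
- by rewrite pm andbT; move: hk; rewrite /hole_line; clear; lia.
- by rewrite bm' andbT; clear -k1; lia.
Qed.

(** Admissible end points give distinct basis rows in increasing order, whose minor sum is 1; an end
    point within the rhombus gives a zero row. *)
Lemma final_minors h : Inv1 A h ->
  minors_sum (fx1 A ++ [seq phi1 A t | t <- h]) = 1 * (final1 h)%:R.
Proof.
case=> sh ph bh gh; rewrite /fx1 inj_linesA /= mul1r /final1.
case: (boolP (all _ _)) => [/allP fh|/allPn[t th nt]]; last first.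
  apply: (altmul_span_map (pre := [::]) (@altmul_minors_sum N) th).
  rewrite /phi1 wrow1_eq0; first exact: span_zero.
  by have := allP gh _ th; move: nt; clear; lia.
pose idx (t : int) : 'I_N := inord (absz (t - n%:Z - 1)%R).
have idxE (t : int) : t \in h -> phi1 A t = delta_mx 0 (idx t).
  move=> th; apply/rowP => c; rewrite wrow1E subnn /= mxE eqxx /=.
  have b1 : `|t| + 1 <= (2 * B + A)%N%:Z := allP bh _ th.
  have b2 : n%:Z < t := fh _ th.
  have -> : ((n + 1 + c)%N%:Z + t == 0) = false by apply/eqP; clear -b2; lia.
  rewrite subr0; congr ((nat_of_bool _)%:R); apply/eqP/eqP => [e|->].
    by apply: val_inj; rewrite /= inordK /N; move: (nat_of_ord c) e b1 b2; clear; lia.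
  by rewrite inordK /N; clear -b1 b2; lia.
have -> : [seq phi1 A t | t <- h] = [seq delta_mx 0 c | c <- map idx h].
  by rewrite -map_comp; apply/eq_in_map => t th; rewrite idxE.
rewrite /minors_sum ext_delta eps_sorted // sorted_map.
apply: (sub_in_sorted (P := mem h)) sh; last exact/allP.
move=> x y xh yh xy /=; rewrite /idx !inordK /N.
- by have := fh _ xh; move: xy; clear; lia.
- by have := fh _ yh; have := allP bh _ yh; clear; lia.
- by have := fh _ xh; have := allP bh _ xh; clear; lia.
Qed.

Lemma pair_coef_wrow2 (c : {ffun 'I_nn -> 'I_N}) j t :
  pair_coef c j (wrow2 n N 0 t)
  = ((if odd j then t else - t) == (n + 1 + c (half_ord j))%N%:Z)%:R.
Proof.
rewrite /pair_coef /wrow2 /=; case: ifP => _; rewrite mxE /= subr_eq0 eq_sym //.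
Qed.

Lemma final_pair_sum h : Inv2 A h ->
  pair_sum nn (fx2 A ++ [seq phi2 A t | t <- h]) = nn`!%:R * (final2 h)%:R.
Proof.
case=> sh ph bh szh; rewrite /fx2 inj_linesA /=; rewrite inj_linesA addn0 in szh.
rewrite /final2; case: (boolP (all _ _)) => [/allP fh|/allPn[t th nt]]; last first.
  rewrite mulr0; have [tn|tn] := lerP `|t| n%:Z.
    apply: (altmul_span_map (pre := [::]) (@altmul_pair_sum nn N) th).
    rewrite /phi2 wrow2_eq0; first exact: span_zero.
    by rewrite subnn addr0.
  rewrite tn andbT in nt.
  apply: big1 => c _; rewrite /det_rows; case: eqP => // sz.
  rewrite size_map in sz; have ht : (index t h < nn + nn)%N by rewrite -sz index_mem.
  (* Here [- t] is not an end point. Either the row of [t] is 0, or it has a nonzero entry in a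
     column [j], and then the partner column is 0, since only an end point [- t] could contribute to
     it. *)
  have [/existsP[j tj]|/existsPn tj] :=
    boolP [exists j : 'I_(nn + nn), pair_coef c j (wrow2 n N 0 t) != 0]; last first.
    rewrite (expand_det_row _ (Ordinal ht)) big1 // => j _; rewrite mxE /= (nth_map 0) ?index_mem //.
    rewrite nth_index // /phi2 subnn; move: (tj j); rewrite negbK => /eqP ->; exact: mul0r.
  have j'lt : ((if odd j then j.-1 else j.+1) < nn + nn)%N.
    exact: swap_ord_lt.
  rewrite (expand_det_col _ (Ordinal j'lt)) big1 // => i _; rewrite mxE (nth_map 0) ?sz //.
  rewrite /phi2 subnn pair_coef_wrow2.
  have -> : half_ord (Ordinal j'lt) = half_ord j by apply: val_inj; apply: swap_ord_half.
  have -> : odd (Ordinal j'lt) = ~~ odd j by apply: swap_ord_odd.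
  move: tj; rewrite pair_coef_wrow2 pnatr_eq0 eqb0 negbK => /eqP <-.
  case: eqP => [e|_]; last exact: mul0r.
  case/negP: nt; suff -> : - t = nth 0 h i by rewrite mem_nth // sz.
  by move: e; case: (odd j) => /= e; rewrite ?e // -e opprK.
have h0 : 0 \notin h by apply/negP => /fh /andP[_]; rewrite normr0; clear; lia.
have hE : h = _ := lt_sorted_sym sh h0 (introT allP (fun t th => proj1 (andP (fh t th)))).
set g := [seq t <- h | 0 < t] in hE.
have szg : size g = nn.
  by apply: double_inj; rewrite -szh hE size_cat size_rev size_map addnn.
have gP t : t \in g -> (n%:Z < t) && (t + 1 <= (2 * B + A)%N%:Z).
  rewrite mem_filter => /andP[t0 th]; have /andP[_] := fh t th; have := allP bh t th.
  by move: t0; clear; lia.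
have -> : [seq phi2 A t | t <- h] = rev (map (@twist N) (map (phi2 A) g)) ++ map (phi2 A) g ++ [::].
  rewrite {1}hE map_cat map_rev cats0 -!map_comp; congr (rev _ ++ _).
  by apply: eq_map => t /=; rewrite /phi2 wrow2N.
rewrite (altmul_pairs (@twist N) _ _ (@altmul_pair_sum nn N)) cats0 pair_sum_pairs ?size_map //.
(* Walks of length 0 do not join positive and negative heights, so Y = 0 and both factors equal X,
   whose rows are distinct basis vectors. *)
rewrite mulr1; suff -> : diff_mx nn (map (phi2 A) g) *m (add_mx nn (map (phi2 A) g))^T = 1%:M.
  by rewrite det1 mulr1.
have row t c : t \in g -> (wrow n N 0 t 0 c = (t == (n + 1 + c)%N%:Z)%:R) /\ (wrow n N 0 (- t) 0 c = 0).
  move=> tg; rewrite !mxE /= opprK subr_eq0 eq_sym; split=> //.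
  by case/andP: (gP t tg) => tn _; case: eqP => //; move: (nat_of_ord c) tn; clear; lia.
have diffE (i : 'I_nn) c : diff_mx nn (map (phi2 A) g) i c = (nth 0 g i == (n + 1 + c)%N%:Z)%:R.
  have gi : nth 0 g i \in g by rewrite mem_nth // szg.
  rewrite mxE (nth_map 0) ?szg // /phi2 subnn [wrow2 _ _ _ _]/=.
  by rewrite mxE [X in _ + X]mxE (row _ c gi).1 (row _ c gi).2 subr0.
have addE (i : 'I_nn) c : add_mx nn (map (phi2 A) g) i c = (nth 0 g i == (n + 1 + c)%N%:Z)%:R.
  have gi : nth 0 g i \in g by rewrite mem_nth // szg.
  rewrite mxE (nth_map 0) ?szg // /phi2 subnn [wrow2 _ _ _ _]/=.
  by rewrite mxE (row _ c gi).1 (row _ c gi).2 addr0.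
apply/matrixP => i j; rewrite [RHS]mxE mxE.
have gi : nth 0 g i \in g by rewrite mem_nth // szg.
have /andP[ti tb] := gP _ gi.
have cN : (absz (nth 0 g i - n%:Z - 1)%R < N)%N by move: ti tb; rewrite /N; clear; lia.
have ci : nth 0 g i = (n + 1 + Ordinal cN)%N%:Z by move: ti => /=; clear; lia.
rewrite (bigD1 (Ordinal cN)) //= big1 ?addr0 => [|c cN']; last first.
  rewrite diffE ci (_ : _ == _ = false) ?mul0r //; apply/negbTE.
  by rewrite eqz_nat eqn_add2l eq_sym.
rewrite [_^T _ _]mxE diffE addE -ci eqxx mul1r eq_sym nth_uniq ?szg //.
by rewrite (sorted_uniq lt_trans lt_irreflexive) // (sorted_filter lt_trans).
Qed.

Lemma start1P t : t \in start1 -> [&& odd `|t|, 0 < t & t + 1 <= (2 * B)%N%:Z].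
Proof. by case/mapP => i; rewrite mem_iota => /andP[_ iB] ->; move: iB; clear; lia. Qed.

Lemma sorted_start1 : sorted <%R start1.
Proof.
rewrite sorted_map; apply: sub_sorted (iota_ltn_sorted 0 B) => i j /=.
by rewrite ltz_nat ltnS ltn_double.
Qed.

Lemma start2P t : t \in start2 -> [&& odd `|t|, t != 0 & `|t| + 1 <= (2 * B)%N%:Z].
Proof.
rewrite mem_cat mem_rev => /orP[/mapP[u /start1P u1 ->]|/start1P]; last by clear; lia.
by move: u1; clear; lia.
Qed.

Lemma sorted_start2 : sorted <%R start2.
Proof.
apply: lt_sorted_cat; last 2 first.
- exact: sorted_start1.
- move=> x y; rewrite mem_rev => /mapP[u /start1P u1 ->] /start1P; move: u1; clear; lia.
by rewrite rev_sorted sorted_map; apply: sub_sorted sorted_start1 => x y /=; rewrite ltrN2.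
Qed.

Lemma Inv1_start : Inv1 0 start1.
Proof.
split; first exact: sorted_start1.
- by apply/allP => t /start1P /and3P[].
- by apply/allP => t /start1P; clear; lia.
- by apply/allP => t /start1P /and3P[].
Qed.

Lemma Inv2_start : Inv2 0 start2.
Proof.
split; first exact: sorted_start2.
- by apply/allP => t /start2P /and3P[].
- by apply/allP => t /start2P; clear; lia.
- by rewrite size_cat size_rev !size_map size_iota addnn -doubleD.
Qed.

(** The depths of the rows once all start at height 1: [A - j] for walkers emitted on line [j], and
    [A + i.*2] for the [i]-th walker of the left side. *)
Let ds := [seq (A - j)%N | j <- inj_lines 0] ++ [seq (A + i.*2)%N | i <- iota 0 B].

Lemma count1E : (count1 0 A start1)%:R = minors_sum [seq wrow1 n N d 1 | d <- ds].
Proof.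
rewrite -[LHS]mul1r -(pcount_altmul (@altmul_minors_sum N) phi1S step1 final_minors (add0n A) Inv1_start).
rewrite /fx1 /ds map_cat -map_comp -[in RHS]map_comp -[RHS]/(minors_sum (_ ++ _)).
have := altmul_staircase1 (@wrow1S n N) (@altmul_minors_sum N) A B
  [seq phi1 j 1 | j <- inj_lines 0] [::] (@wrow1N n N).
by rewrite !cats0 => <-; rewrite /start1 -map_comp /phi1 subn0.
Qed.

Hypothesis nA : (n <= A)%N.

Lemma good_ds : all (fun d => [&& (n <= d)%N, (d < n + N)%N & odd d == odd A]) ds.
Proof.
rewrite all_cat; apply/andP; split; apply/allP => d /mapP[j].
  rewrite mem_filter => /andP[hj _] ->; have := hole_lineA hj; case/andP: hj => oj _.
  by move: oj; rewrite /N; clear; lia.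
by rewrite mem_iota => jB ->; move: jB nA; rewrite /N; clear; lia.
Qed.

(** Both counts reduce to the same depths [ds], where [pair_sum_minors] applies; the factorial of
    [nn], due to summing over maps, cancels. *)
Lemma count_sq : count2 0 A start2 = (count1 0 A start1 ^ 2)%N.
Proof.
apply/eqP; rewrite -eqz_nat -!natz natrX count1E.
have nz : (nn`!%:R : int) != 0 by rewrite pnatr_eq0 -lt0n fact_gt0.
apply/eqP; apply: (mulfI nz).
have sds : size ds = nn by rewrite size_cat !size_map size_iota addnC.
have := pair_sum_minors good_ds; rewrite sds => <-.
rewrite -(pcount_altmul (@altmul_pair_sum nn N) phi2S step2 final_pair_sum (add0n A) Inv2_start).
have -> : [seq phi2 0 t | t <- start2]
   = rev (map (@twist N) (map (phi2 0) start1)) ++ map (phi2 0) start1 ++ [::].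
  rewrite map_cat map_rev cats0; congr (rev _ ++ _).
  rewrite -(map_comp (phi2 0) -%R) -(map_comp (@twist N)).
  by apply: eq_map => t /=; rewrite /phi2 wrow2N.
rewrite (altmul_pairs (@twist N) _ _ (altmul_cat (fx2 0) (@altmul_pair_sum nn N))) cats0.
have := altmul_staircase2 (@wrow2S n N) (@altmul_pair_sum nn N) A B (fx2 0) [::] (@wrow2N n N).
rewrite !cats0 /start1 -map_comp /phi2 subn0 => ->.
by rewrite /fx2 -pairs_cat /ds map_cat -!map_comp.
Qed.

End Process.

(** * Runs of walkers *)

Local Notation column := (seq (int * bool)).

Section Runs.
Variables (ok : nat -> seq int -> bool) (inj : nat -> seq int -> seq int).
Variable final : seq int -> bool.

(** The families counted by [pcount], listed explicitly for the bijection with tilings. *)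
Fixpoint runs (k j : nat) (h : seq int) : seq (seq column) :=
  if j is j'.+1 then
    flatten [seq if ok k.+1 (mv c) then [seq c :: r | r <- runs k.+1 j' (inj k.+1 (mv c))] else [::]
            | c <- cols h]
  else if final h then [:: [::]] else [::].

Fixpoint valid (k : nat) (h : seq int) (r : seq column) : bool :=
  if r is c :: r' then
    [&& unzip1 c == h, ok k.+1 (mv c) & valid k.+1 (inj k.+1 (mv c)) r']
  else final h.

Lemma size_runs k j h : size (runs k j h) = pcount ok inj final k j h.
Proof.
elim: j k h => [|j IHj] k h /=; first by case: (final h).
rewrite size_flatten /shape -map_comp sumnE big_map; apply: eq_bigr => c _ /=.
by case: ifP => _ //; rewrite size_map IHj.
Qed.

Lemma mem_runs k j h r : (r \in runs k j h) = (size r == j) && valid k h r.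
Proof.
elim: j k h r => [|j IHj] k h r /=.
  by case: r => [|c r] /=; case: (final h); rewrite ?inE.
apply/flattenP/andP => [[s /mapP[c ch ->]]|].
  case: ifP => // okc /mapP[r']; rewrite IHj => /andP[sr vr] ->.
  by rewrite /= eqSS sr okc vr -mem_cols ch.
case: r => [|c r] [] //=; rewrite eqSS => sr /and3P[ch okc vr].
exists [seq c :: r | r <- runs k.+1 j (inj k.+1 (mv c))].
  by apply/mapP; exists c; rewrite ?mem_cols ?okc.
by apply/mapP; exists r => //; rewrite IHj sr.
Qed.

Lemma uniq_runs k j h : uniq (runs k j h).
Proof.
elim: j k h => [|j IHj] k h /=; first by case: (final h).
have := uniq_cols h; elim: (cols h) => //= c s IHs /andP[cs us].
rewrite cat_uniq IHs // andbT; apply/andP; split.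
  by case: ifP => // _; rewrite map_inj_uniq ?IHj // => ? ? [].
apply/hasPn => r /flattenP[t /mapP[c' c's ->]]; case: ifP => // _ /mapP[r' _ ->].
case: ifP => // _; apply/mapP => -[r'' _ [cc' _]].
by rewrite -cc' c's in cs.
Qed.

Lemma valid_nthP k h r : valid k h r ->
  (forall i, (i < size r)%N ->
     unzip1 (nth [::] r i) = (if i is i'.+1 then inj (k + i) (mv (nth [::] r i')) else h)
     /\ ok (k + i).+1 (mv (nth [::] r i)))
  /\ final (if size r is s.+1 then inj (k + size r) (mv (nth [::] r s)) else h).
Proof.
elim: r k h => [|c r IHr] k h //= /and3P[/eqP ch okc /IHr[IH1 IH2]]; split.
  case=> [|i] ir; first by rewrite addn0.
  have [-> okn] := IH1 i ir; rewrite addnS -addSn; split=> //.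
  by case: i {ir okn} => //=; rewrite addn0.
by rewrite -addSnnS; move: IH2; case: (size r) => [|s] //; rewrite addn0.
Qed.

End Runs.

Definition flipc (e : int * bool) : int * bool := (- e.1, ~~ e.2).
(** Invariance under reflection across the horizontal axis; the reversal restores the increasing
    order of heights. *)
Definition symcol (c : column) : bool := c == rev (map flipc c).
Definition mirror (g : seq int) : seq int := rev (map -%R g) ++ g.
Definition mirrorc (d : column) : column := rev (map flipc d) ++ d.

Lemma flipcK : involutive flipc.
Proof. by case=> m b; rewrite /flipc /= opprK negbK. Qed.

Lemma unzip1_mirrorc d : unzip1 (mirrorc d) = mirror (unzip1 d).
Proof. by rewrite /mirrorc /mirror /unzip1 map_cat map_rev -!map_comp. Qed.

Lemma mv_mirrorc d : mv (mirrorc d) = mirror (mv d).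
Proof.
rewrite /mirrorc /mirror /mv map_cat map_rev -!map_comp; congr (rev _ ++ _).
by apply: eq_map => -[m []]; rewrite /step /flipc /=; ring.
Qed.

Lemma perm_symcols g :
  perm_eq [seq c <- cols (mirror g) | symcol c] [seq mirrorc d | d <- cols g].
Proof.
apply: uniq_perm; first by rewrite filter_uniq ?uniq_cols.
  rewrite map_inj_uniq ?uniq_cols // => d d' /eqP.
  rewrite /mirrorc; move=> e; have sz : size d = size d'.
    by have := congr1 size (eqP e); rewrite !size_cat !size_rev !size_map !addnn => /double_inj.
  by move: e; rewrite eqseq_cat ?size_rev ?size_map ?sz // => /andP[_ /eqP].
move=> c; rewrite mem_filter mem_cols; apply/andP/mapP => [[sc /eqP uc]|[d]].
  have szc : size c = (size g + size g)%N.
    by have := congr1 size uc; rewrite size_map size_cat size_rev size_map.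
  exists (drop (size g) c).
    rewrite mem_cols /unzip1 map_drop -/(unzip1 c) uc drop_size_cat //.
    by rewrite size_rev size_map.
  move: sc; rewrite /symcol -{1 2}(cat_take_drop (size g) c) map_cat rev_cat eqseq_cat.
    by case/andP => /eqP e _; rewrite /mirrorc -e cat_take_drop.
  by rewrite size_rev size_map size_take size_drop szc; case: ifP; lia.
rewrite mem_cols => /eqP <- ->; rewrite unzip1_mirrorc eqxx; split=> //.
rewrite /symcol /mirrorc map_cat rev_cat map_rev revK -map_comp; apply/eqP; congr (_ ++ _).
by rewrite (eq_map flipcK) map_id.
Qed.

(** * Symmetric families and their upper halves *)

Section Mirror.
Variables (A B n : nat) (ks : seq nat).

Lemma half_regN k m : half_reg A B n ks k (- m) = half_reg A B n ks k m.
Proof. by rewrite /half_reg /half_hole !normrN oppr_eq0. Qed.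

(** In the increasing list [mirror g] each [- t] precedes [t], which forces positive heights. *)
Lemma ok2_mirror k g : ok2 A B n ks k (mirror g) = ok1 A B n ks k g.
Proof.
rewrite /ok2 /ok1 /mirror all_cat all_rev all_map.
rewrite (eq_all (a2 := half_reg A B n ks k.-1)) ?andbb; last by move=> t; apply: half_regN.
have -> : all (fun t => (0 < t) && half_reg A B n ks k.-1 t) g
    = all (fun t => 0 < t) g && all (half_reg A B n ks k.-1) g by exact: all_predI.
apply/andP/and3P => [[s rg]|[s p rg]]; split=> //.
- by move: s; rewrite !(sorted_pairwise lt_trans) pairwise_cat => /and3P[].
- apply/allP => t tg; move: s; rewrite (sorted_pairwise lt_trans) pairwise_cat => /andP[/allrelP s _].
  have : - t < t by apply: s => //; rewrite mem_rev map_f.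
  by clear; lia.
apply: lt_sorted_cat => //.
  by rewrite rev_sorted sorted_map; apply: sub_sorted s => x y /=; rewrite ltrN2.
move=> x y; rewrite mem_rev => /mapP[u ug ->] yg.
by have := allP p u ug; have := allP p y yg; clear => /=; lia.
Qed.

Lemma inj2_mirror k g : all (fun t => 0 < t) g -> inj2 ks k (mirror g) = mirror (inj1 ks k g).
Proof.
move=> /allP pg; rewrite /inj2 /inj1; case: ifP => // _.
have -> : [seq t <- mirror g | t < 0] = rev (map -%R g).
  rewrite filter_cat (@eq_in_filter _ _ xpredT (rev _)) ?filter_predT; last first.
    by move=> t; rewrite mem_rev => /mapP[u /pg u0 ->]; rewrite oppr_lt0.
  rewrite (@eq_in_filter _ _ pred0 g) ?filter_pred0 ?cats0 //.
  by move=> t /pg t0 /=; apply/negbTE; rewrite -leNgt ltW.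
have -> : [seq t <- mirror g | 0 < t] = g.
  rewrite filter_cat (@eq_in_filter _ _ xpredT g) ?filter_predT; last by move=> t /pg.
  rewrite (@eq_in_filter _ _ pred0 (rev _)) ?filter_pred0 //.
  by move=> t; rewrite mem_rev => /mapP[u /pg u0 ->] /=; apply/negbTE; rewrite -leNgt oppr_le0 ltW.
by rewrite /mirror /= rev_cons cat_rcons.
Qed.

Lemma final2_mirror g : all (fun t => 0 < t) g -> final2 n (mirror g) = final1 n g.
Proof.
move=> /allP pg; rewrite /final2 /final1; apply/allP/allP => [fg t tg|fg t].
  have := fg t; rewrite mem_cat tg orbT => /(_ isT) /andP[_].
  by have := pg t tg; clear; lia.
rewrite mem_cat mem_rev => /orP[/mapP[u ug ->]|tg].
  by rewrite opprK mem_cat ug orbT normrN; have := fg u ug; have := pg u ug; clear; lia.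
by rewrite mem_cat mem_rev map_f //; have := fg t tg; clear; lia.
Qed.

(** The symmetric columns leaving [mirror g] are the mirrors of the columns leaving [g], and the
    tests and emissions correspond. *)
Lemma size_symruns k j g : all (fun t => 0 < t) g ->
  size [seq r <- runs (ok2 A B n ks) (inj2 ks) (final2 n) k j (mirror g) | all symcol r]
  = count1 A B n ks k j g.
Proof.
elim: j k g => [|j IHj] k g pg; first by rewrite /= final2_mirror //; case: final1.
rewrite [RHS]/= [runs _ _ _ _ _ _]/= filter_flatten size_flatten /shape -!map_comp sumnE big_map.
rewrite (bigID symcol) /= [X in (_ + X)%N]big1 ?addn0; last first.
  move=> c /negPf sc; case: ifP => // _; rewrite filter_map size_map.
  by rewrite (eq_filter (a2 := pred0)) ?filter_pred0 // => r /=; rewrite sc.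
rewrite -big_filter (perm_big _ (perm_symcols g)) big_map !big_seq; apply: eq_bigr => d.
rewrite mem_cols => /eqP dg; rewrite mv_mirrorc ok2_mirror; case: ifP => // okd.
have pd : all (fun t => 0 < t) (mv d) by case/andP: okd => _ /allP okd; apply/allP => t /okd /andP[].
rewrite inj2_mirror // filter_map size_map -IHj; last first.
  by rewrite /inj1; case: ifP => //= _.
congr (size _); apply: eq_filter => r /=.
have -> : symcol (mirrorc d) by have := perm_mem (perm_symcols g) (mirrorc d); rewrite mem_filter map_f ?mem_cols ?dg // => /andP[].
by [].
Qed.
End Mirror.

(** * Tilings and runs *)

Lemma left_pointingE (k : nat) (m : int) : left_pointing (k%:Z, m) = ~~ odd (k + `|m|).
Proof. by rewrite /left_pointing /=; lia. Qed.

Lemma adjacentE (t u : tri) : adjacent t u =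
  [|| u == (t.1, t.2 + 1), u == (t.1, t.2 - 1)
    | u == (if left_pointing t then t.1 + 1 else t.1 - 1, t.2)].
Proof.
case: t u => [k m] [k' m']; rewrite /adjacent /left_pointing /= !xpair_eqE /=.
case: (boolP (odd `|k + m|)) => /=; lia.
Qed.

Lemma rot180K A : involutive (rot180 A).
Proof. by case=> k m; rewrite /rot180 /= opprK; congr (_, _); ring. Qed.

Lemma left_pointing_rot A t : left_pointing (rot180 A t) = ~~ left_pointing t.
Proof. by case: t => k m; rewrite /left_pointing /rot180 /=; lia. Qed.

Lemma adjacent_rot A t u : adjacent (rot180 A t) (rot180 A u) = adjacent t u.
Proof.
rewrite !adjacentE left_pointing_rot /rot180; case: t u => [k m] [k' m'] /=; rewrite !xpair_eqE /=.
by case: left_pointing => /=; lia.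
Qed.

(** Together with the rotation it generates the same group as [reflV] does, and unlike [reflV] it
    preserves the left half. *)
Definition flipH (t : tri) : tri := (t.1, - t.2).

Lemma flipHK : involutive flipH.
Proof. by case=> k m; rewrite /flipH /= opprK. Qed.

Lemma rot_flipH A t : rot180 A (flipH t) = reflV A t.
Proof. by case: t => k m; rewrite /rot180 /reflV /flipH /= opprK. Qed.

Lemma flipH_rot A t : flipH (rot180 A t) = rot180 A (flipH t).
Proof. by case: t. Qed.

Lemma adjacent_flipH t u : adjacent (flipH t) (flipH u) = adjacent t u.
Proof.
have lf : left_pointing (flipH t) = left_pointing t.
  by case: t => k m; rewrite /left_pointing /flipH /=; lia.
rewrite !adjacentE lf; case: t u {lf} => [k m] [k' m'] /=; rewrite /flipH !xpair_eqE /=.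
by case: left_pointing => /=; lia.
Qed.

(** * Triangles sharing a vertical side *)

Section HalfRegion.
Variables (A B n : nat) (ks : seq nat).
Hypothesis nA : (n <= A)%N.
Hypothesis npar : (n == 0%N) || (odd n == odd A).
Hypothesis hole_lineA : forall k, hole_line ks k -> (2 <= k)%N && (k + n <= A)%N.
Local Notation hole_line := (hole_line ks).
Local Notation half_reg := (half_reg A B n ks).

Lemma hole_line_even k : hole_line k -> ~~ odd k.
Proof. by case/andP. Qed.

(** The two triangles share a vertical side on line [k.+1]. Parity prevents the rhombus and the tips
    of holes from separating them, so only the vertical side of a hole can. *)
Lemma half_regS k m : (k.+1 < A)%N -> ~~ odd (k + `|m|) ->
  half_reg k m = half_reg k.+1 m && ~~ (hole_line k.+1 && (`|m| <= 1)).
Proof.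
move=> kA km; rewrite /half_reg /half_hole.
have h2 : hole_line k.+2 -> (m == 0) = (`|m| <= 1).
  by move/hole_line_even => /=; rewrite negbK; move: km; clear; lia.
have h3 : hole_line k.+3 && (m == 0) = false.
  by apply/negbTE/andP => -[/hole_line_even /= h /eqP m0]; move: h km; rewrite m0; clear; lia.
have -> : (`|m| <= (2 * B + k)%N%:Z) = (`|m| <= (2 * B + k.+1)%N%:Z) by move: km; clear; lia.
have -> : (n%:Z < A%:Z - k%:Z + `|m|) = (n%:Z < A%:Z - k.+1%:Z + `|m|).
  by move: npar kA km; clear; lia.
rewrite h3 /=; have h2' : hole_line k.+2 && (m == 0) = hole_line k.+2 && (`|m| <= 1).
  by case: (boolP (hole_line k.+2)) => // /h2 ->.
rewrite h2'; move: (hole_line k.+2) (hole_line k.+1) (`|m| <= 1) (`|m| <= _) (_ < _) => {h2 h2'}.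
by do 5!case.
Qed.

Lemma half_reg_inj k m : hole_line k -> (k < A)%N -> `|m| = 1 -> half_reg k m.
Proof.
move=> hk kA m1; have := hole_lineA hk; rewrite /half_reg /half_hole m1 lexx andbT => /andP[k2 kn].
have -> : m == 0 = false by apply/negbTE; move: m1; clear; lia.
rewrite andbF /=; apply/and3P; split; try by move: k2 kn; clear; lia.
by apply/negP => /hole_line_even; move: (hole_line_even hk) => /=; case: odd.
Qed.

Lemma half_reg_start (m : int) : (0 < A)%N -> odd `|m| -> half_reg 0 m = (m \in start2 B).
Proof.
move=> A0 om; apply/idP/idP => [/and3P[bm _ _]|/start2P /and3P[_ m0 bm]].
  have mB : (`|m|%N./2 < B)%N by move: om bm; clear; lia.
  rewrite mem_cat mem_rev; have [m0|m0] := lerP 0 m.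
    by apply/orP; right; apply/mapP; exists `|m|%N./2; rewrite ?mem_iota //; move: om m0; clear; lia.
  apply/orP; left; apply/mapP; exists (- m); last by rewrite opprK.
  by apply/mapP; exists `|m|%N./2; rewrite ?mem_iota //; move: om m0; clear; lia.
apply/and3P; split; try by move: bm m0 nA A0; clear; lia.
by rewrite /half_hole (negPf m0) andbF.
Qed.

End HalfRegion.

(** * Rotation-invariant tilings as runs of walkers *)

Section Bijection.
Variables (A B n : nat) (ks : seq nat) (R : {fset tri}).
Hypothesis A0 : (0 < A)%N.
Hypothesis nA : (n <= A)%N.
Hypothesis npar : (n == 0%N) || (odd n == odd A).
Hypothesis hole_lineA : forall k, hole_line ks k -> (2 <= k)%N && (k + n <= A)%N.
Local Notation hole_line := (hole_line ks).
Local Notation half_reg := (half_reg A B n ks).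
Local Notation ok2 := (ok2 A B n ks).
Local Notation inj2 := (inj2 ks).
Local Notation final2 := (final2 n).
Local Notation rot := (rot180 A).
Hypothesis R_half : forall (k : nat) (m : int), (k < A)%N -> ((k%:Z, m) \in R) = half_reg k m.
Hypothesis R_rot : forall t : tri, (rot t \in R) = (t \in R).
Hypothesis R_box : forall t : tri, t \in R -> (0 <= t.1) && (t.1 < (2 * A)%N%:Z).

(** Partner maps on all triangles, constrained only on [R], avoid carrying membership proofs. *)
Definition tilingF (F : tri -> tri) : Prop :=
  forall t, t \in R -> [/\ F t \in R, adjacent t (F t), F (F t) = t & F (rot t) = rot (F t)].

(* The right-pointing triangle [(k, m)] is not covered by a horizontal lozenge, so a walker
   passes through its vertical side. *)
Definition occ (F : tri -> tri) (k : nat) (m : int) : bool :=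
  [&& odd (k + `|m|), (k%:Z, m) \in R & F (k%:Z, m) != (k%:Z - 1, m)].

Definition irange : seq int := [seq i%:Z - (2 * B + A)%N%:Z | i <- iota 0 (2 * (2 * B + A)).+1].
Definition occl F k : seq int := [seq m <- irange | occ F k m].
Definition colF F k : seq (int * bool) := [seq (m, F (k%:Z, m) == (k%:Z, m + 1)) | m <- occl F k].
Definition enc F : seq (seq (int * bool)) := [seq colF F k | k <- iota 0 A].

Lemma mem_irange m : (m \in irange) = (`|m| <= (2 * B + A)%N%:Z).
Proof.
apply/mapP/idP => [[i]|mb]; first by rewrite mem_iota => ib ->; move: ib; clear; lia.
exists (absz (m + (2 * B + A)%N%:Z)%R); first by rewrite mem_iota; move: mb; clear; lia.
by move: mb; clear; lia.
Qed.

Lemma sorted_irange : sorted <%R irange.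
Proof.
rewrite sorted_map; apply: sub_sorted (iota_ltn_sorted 0 _) => i j /= ij.
by rewrite /= ltrD2r ltz_nat.
Qed.

Lemma sorted_occl F k : sorted <%R (occl F k).
Proof. by apply: (sorted_filter lt_trans); apply: sorted_irange. Qed.

Lemma mem_occl F k m : (k < A)%N -> (m \in occl F k) = occ F k m.
Proof.
move=> kA; rewrite mem_filter mem_irange andb_idr // => /and3P[_].
by rewrite R_half // => /and3P[mb _ _] _; move: mb kA; clear; lia.
Qed.

Lemma unzip1_colF F k : unzip1 (colF F k) = occl F k.
Proof. by rewrite /unzip1 -map_comp -[RHS]map_id; apply: eq_map. Qed.

Lemma R_right k m : (k.+1 < A)%N -> ~~ odd (k + `|m|) ->
  ((k%:Z, m) \in R) = ((k.+1%:Z, m) \in R) && ~~ (hole_line k.+1 && (`|m| <= 1)).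
Proof. by move=> kA km; rewrite (R_half _ (ltnW kA)) (R_half _ kA) (@half_regS A B n ks npar k m kA km). Qed.

(** * From tilings to runs *)

Section Encode.
Variable F : tri -> tri.
Hypothesis tF : tilingF F.

Lemma right_cases k m : (k%:Z, m) \in R -> odd (k + `|m|) ->
  [\/ F (k%:Z, m) = (k%:Z, m + 1), F (k%:Z, m) = (k%:Z, m - 1) | F (k%:Z, m) = (k%:Z - 1, m)].
Proof.
move=> tR om; have [_ + _ _] := tF tR; rewrite adjacentE left_pointingE om /=.
by case/or3P => /eqP ->; [apply: Or31|apply: Or32|apply: Or33].
Qed.

Lemma left_cases k m : (k%:Z, m) \in R -> ~~ odd (k + `|m|) ->
  [\/ F (k%:Z, m) = (k%:Z, m + 1), F (k%:Z, m) = (k%:Z, m - 1) | F (k%:Z, m) = (k%:Z + 1, m)].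
Proof.
move=> tR om; have [_ + _ _] := tF tR; rewrite adjacentE left_pointingE om /=.
by case/or3P => /eqP ->; [apply: Or31|apply: Or32|apply: Or33].
Qed.

Lemma colF_step k e : (k < A)%N -> e \in colF F k ->
  [/\ odd (k + `|e.1|), (k%:Z, e.1) \in R, F (k%:Z, e.1) = (k%:Z, step e)
    , (k%:Z, step e) \in R & F (k%:Z, step e) = (k%:Z, e.1)].
Proof.
move=> kA /mapP[m]; rewrite mem_occl // => /and3P[om mR mF] ->.
have Fe : F (k%:Z, m) = (k%:Z, step (m, F (k%:Z, m) == (k%:Z, m + 1))).
  rewrite /step /=; case: eqP => [//|ne].
  by case: (right_cases mR om) => [/ne|//|e'] //; rewrite e' eqxx in mF.
by have [FR _ FK _] := tF mR; rewrite /= -Fe FK.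
Qed.

Lemma mem_mv_colF k m : (k < A)%N -> (m \in mv (colF F k)) =
  [&& ~~ odd (k + `|m|), (k%:Z, m) \in R & F (k%:Z, m) != (k%:Z + 1, m)].
Proof.
move=> kA; apply/mapP/and3P => [[e ec ->]|[om mR mF]].
  have [oe _ _ sR ->] := colF_step kA ec; split=> //.
    by move: oe; rewrite /step; case: (e) => x [] /=; clear; lia.
  by rewrite xpair_eqE negb_and; apply/orP; left; clear; lia.
have [m0 Fm om0] : exists2 m0, F (k%:Z, m) = (k%:Z, m0) & (m0 = m + 1) \/ (m0 = m - 1).
  case: (left_cases mR om) => e; first by exists (m + 1) => //; left.
    by exists (m - 1) => //; right.
  by rewrite e eqxx in mF.
have [m0R _ FK _] := tF mR; rewrite Fm in m0R FK.
exists (m0, F (k%:Z, m0) == (k%:Z, m0 + 1)).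
  apply: map_f; rewrite mem_occl // /occ m0R FK xpair_eqE negb_and.
  apply/and3P; split=> //; first by case: om0 => ->; move: om; clear; lia.
  by apply/orP; left; clear; lia.
rewrite /step /= FK xpair_eqE eqxx /=; case: om0 => ->; last by rewrite subrK eqxx.
by rewrite addrK; case: eqP => // e; move: e; clear; lia.
Qed.

Lemma parity_occl k : (k < A)%N -> all (fun t : int => odd (k + `|t|)) (occl F k).
Proof. by move=> kA; apply/allP => t; rewrite mem_occl // => /and3P[]. Qed.

Lemma ok2_colF k : (k < A)%N -> ok2 k.+1 (mv (colF F k)).
Proof.
move=> kA; apply/andP; split; last first.
  by apply/allP => m; rewrite mem_mv_colF // => /and3P[_]; rewrite R_half.
rewrite lt_sorted_uniq_le (mv_sorted_le (k := k)) ?unzip1_colF ?sorted_occl ?parity_occl // andbT.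
rewrite map_inj_in_uniq.
  by apply: (@map_uniq _ _ fst); rewrite -/unzip1 unzip1_colF (sorted_uniq lt_trans lt_irreflexive) ?sorted_occl.
move=> e e' /[dup] ec /(colF_step kA)[_ _ _ _ Fe] /[dup] ec' /(colF_step kA)[_ _ _ _ Fe'] se.
move: Fe Fe'; rewrite se => -> [ee'].
case/mapP: ec ee' => m _ ->; case/mapP: ec' => m' _ -> /= ->.
by [].
Qed.

(** A horizontal lozenge across a side on line [k.+1] is seen from both of its halves, so arriving
    walkers continue. The only further walkers start at the vertical side of a hole, where there is
    no left half. *)
Lemma inj2_colF k : (k.+1 < A)%N -> inj2 k.+1 (mv (colF F k)) = occl F k.+1.
Proof.
move=> kA; have kA' := ltnW kA; have /andP[so rg] := ok2_colF kA'.
have key m : (m \in mv (colF F k)) = occ F k.+1 m && ~~ (hole_line k.+1 && (`|m| <= 1)).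
  rewrite mem_mv_colF // /occ.
  have -> : odd (k.+1 + `|m|) = ~~ odd (k + `|m|) by [].
  case: (boolP (odd (k + `|m|))) => //= om; rewrite R_right //.
  case: (boolP ((k.+1%:Z, m) \in R)) => //= mR.
  case: (boolP (_ && (_ <= 1))) => nh /=; rewrite ?andbF // andbT; congr (~~ _).
  have mR' : (k%:Z, m) \in R by rewrite R_right // mR.
  have [_ _ K1 _] := tF mR; have [_ _ K2 _] := tF mR'.
  have kk : k.+1%:Z - 1 = k%:Z by clear; lia.
  have kk' : k%:Z + 1 = k.+1%:Z by clear; lia.
  by rewrite kk kk'; apply/eqP/eqP => e; rewrite -e ?K1 ?K2.
rewrite /inj2; case: (boolP (hole_line k.+1)) => hk; last first.
  apply: lt_sorted_eq => //; first exact: sorted_occl.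
  by move=> m; rewrite key (negPf hk) /= andbT mem_occl.
have far m : m \in mv (colF F k) -> 1 < `|m| by rewrite key hk /= -ltNge => /andP[].
have occ1 m : `|m| = 1 -> occ F k.+1 m.
  move=> m1; apply/and3P; split.
  - by have := hole_line_even hk; move: m1 => /=; clear; lia.
  - by rewrite R_half // (@half_reg_inj A B n ks).
  - have mR : (k.+1%:Z, m) \in R by rewrite R_half // (@half_reg_inj A B n ks).
    have [FR _ _ _] := tF mR; apply: contraTneq FR => ->.
    have -> : k.+1%:Z - 1 = k%:Z by clear; lia.
    by rewrite R_half // /half_reg /half_hole hk m1 lexx orbT andbF.
apply: lt_sorted_eq; last 2 first.
- exact: sorted_occl.
- move=> m; rewrite mem_occl // !mem_cat !mem_filter !inE key hk /= -ltNge.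
  case: (boolP (occ F k.+1 m)) => [om|nom] /=.
    have m0 : m != 0.
      by case/and3P: om => + _ _; have := hole_line_even hk => /=; clear; lia.
    by move: m0; clear; lia.
  rewrite !andbF !orbF /=; apply/negbTE; apply: contra nom => m1; apply: occ1; move: m1; clear; lia.
apply: lt_sorted_cat; first exact: (sorted_filter lt_trans).
  apply: (lt_sorted_cat (h1 := [:: -1; 1])) => //; first exact: (sorted_filter lt_trans).
  by move=> x y; rewrite mem_filter !inE => /orP[]/eqP-> /andP[y0 /far]; move: y0; clear; lia.
move=> x y; rewrite mem_filter => /andP[x0 /far x1].
rewrite mem_cat mem_filter !inE => /orP[/orP[]/eqP->|/andP[y0 _]]; move: x0 x1; last by move: y0; clear; lia.
  by clear; lia.
by clear; lia.
Qed.

(** Triangles on the left side of the hexagon have no left neighbour in the region, so each of them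
    emits a walker. *)
Lemma occl_start : occl F 0 = start2 B.
Proof.
apply: lt_sorted_eq; [exact: sorted_occl|exact: sorted_start2|move=> m].
rewrite mem_occl // /occ add0n R_half //; have [om|om] := boolP (odd `|m|); last first.
  by apply/esym/negbTE; apply: contra om => /start2P /and3P[].
rewrite (@half_reg_start A B n ks nA m A0 om) /=; case: (boolP (m \in start2 B)) => //= ms.
apply/negP => /eqP e; have mR : (0%:Z, m) \in R by rewrite R_half // (@half_reg_start A B n ks nA m A0 om).
by have [FR _ _ _] := tF mR; have := R_box FR; rewrite e.
Qed.

(* A walker ending at height 0 is locally possible when [n = 0] and [A] is odd; parity excludes it. *)
Lemma sym_even_notin0 (h : seq int) : sorted <%R h -> all (fun t => - t \in h) h ->
  ~~ odd (size h) -> 0 \notin h.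
Proof.
move=> sh /allP symh; apply: contra => h0.
pose h' := [seq t <- h | t != 0].
have sh' : sorted <%R h' by apply: (sorted_filter lt_trans).
have h'0 : 0 \notin h' by rewrite mem_filter eqxx.
have symh' : all (fun t => - t \in h') h'.
  by apply/allP => t; rewrite !mem_filter oppr_eq0 => /andP[-> /symh].
have uh : uniq h by apply: (sorted_uniq lt_trans lt_irreflexive).
have -> : size h = (size h').+1.
  rewrite -(count_predC (pred1 (0 : int))) (count_uniq_mem 0 uh) /h' size_filter -add1n.
  by rewrite [X in nat_of_bool X]h0.
by rewrite (lt_sorted_sym sh' h'0 symh') size_cat size_rev size_map addnn /= odd_double.
Qed.

Lemma final2_colF : Inv2 A B ks A (inj2 A (mv (colF F A.-1))) -> final2 (inj2 A (mv (colF F A.-1))).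
Proof.
have A1 : (A.-1 < A)%N by rewrite prednK.
have AE : A = A.-1.+1 by rewrite prednK.
case=> sh ph _ szh; set h := inj2 _ _ in sh ph szh *.
have memh t : (t \in h) = (t \in mv (colF F A.-1)) || (hole_line A && (`|t| == 1)).
  rewrite /h /inj2; case: (boolP (hole_line A)) => hk; last by rewrite orbF.
  rewrite !mem_cat !mem_filter !inE /=.
  case: (boolP (t \in mv _)) => [tm|_] /=; last by rewrite !andbF /=; clear; lia.
  have : t != 0; last by clear; lia.
  apply: contraTneq tm => ->; rewrite mem_mv_colF // absz0 addn0.
  by apply/negP => /andP[]; have := hole_line_even hk; rewrite {1}AE /= negbK => ->.
have symh : all (fun t => - t \in h) h.
  apply/allP => t; rewrite !memh normrN => /orP[|->]; last by rewrite orbT.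
  rewrite !mem_mv_colF // abszN => /and3P[-> tR nF] /=; apply/orP; left.
  have tR' : (A.-1%:Z, - t) \in R by move: tR; rewrite !R_half // half_regN.
  rewrite tR' /=; apply: contra nF => /eqP e.
  (* A horizontal lozenge crossing the axis at height [- t] rotates onto one crossing it at height
     [t]. *)
  have [_ _ _] := tF tR'; rewrite e => e'.
  have := tF tR => -[FR _ FK _].
  have e1 : rot (A.-1%:Z, - t) = (A.-1%:Z + 1, t) by rewrite /rot180 /= opprK; congr (_, _); move: A0; clear; lia.
  have e2 : rot (A.-1%:Z + 1, - t) = (A.-1%:Z, t) by rewrite /rot180 /= opprK; congr (_, _); move: A0; clear; lia.
  rewrite e1 e2 in e'; have uR : (A.-1%:Z + 1, t) \in R by rewrite -e1 R_rot.
  by have [_ _ + _] := tF uR; rewrite e' => ->.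
have h0 : 0 \notin h.
  apply: sym_even_notin0 => //.
  by move: szh; rewrite inj_linesA addn0 => ->; rewrite odd_double.
apply/allP => t th; rewrite (allP symh) //=.
have t0 : t != 0 by apply: contraNneq h0 => <-.
have pt := allP ph _ th; move: th; rewrite memh => /orP[|/andP[hk /eqP ->]]; last first.
  by have := hole_lineA hk; clear; lia.
(* Being outside the rhombus in the last strip only gives that [t] has absolute value at least [n];
   equality is excluded by parity, or by [t0] when [n] is 0. *)
rewrite mem_mv_colF // R_half // => /and3P[om /and3P[_ _ rn] _].
by move: om rn npar t0 A0; clear; lia.
Qed.

Lemma valid_enc : valid ok2 inj2 final2 0 (start2 B) (enc F).
Proof.
rewrite /enc -occl_start.
have : Inv2 A B ks 0 (occl F 0) by rewrite occl_start; apply: Inv2_start.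
suff gen j k : (k + j.+1)%N = A -> Inv2 A B ks k (occl F k) ->
    valid ok2 inj2 final2 k (occl F k) [seq colF F i | i <- iota k j.+1].
  by move=> I0; have := gen A.-1 0%N; rewrite prednK // add0n; apply.
elim: j k => [|j IHj] k kj Ik.
  rewrite /= unzip1_colF eqxx /=.
  have kA : k = A.-1 by move: kj; clear; lia.
  have kA' : (k < A)%N by move: kj; clear; lia.
  have := @step2 A B n ks hole_lineA k (occl F k) (colF F k) kA' Ik (unzip1_colF F k).
  rewrite ok2_colF // => -[I' _] /=.
  have AE : k.+1 = A by move: kj; clear; lia.
  by rewrite AE kA in I' *; apply: final2_colF.
have kA : (k.+1 < A)%N by move: kj; clear; lia.
have kA' := ltnW kA.
rewrite -[valid _ _ _ _ _ _]/([&& unzip1 (colF F k) == occl F k, ok2 k.+1 (mv (colF F k))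
  & valid ok2 inj2 final2 k.+1 (inj2 k.+1 (mv (colF F k))) [seq colF F i | i <- iota k.+1 j.+1]]).
rewrite unzip1_colF eqxx andTb.
have := @step2 A B n ks hole_lineA k (occl F k) (colF F k) kA' Ik (unzip1_colF F k).
rewrite ok2_colF // => -[I' _]; rewrite inj2_colF // in I'; rewrite inj2_colF // andTb.
by apply: IHj => //; move: kj; clear; lia.
Qed.

Lemma mem_colF k m b : (k < A)%N ->
  ((m, b) \in colF F k) = occ F k m && (b == (F (k%:Z, m) == (k%:Z, m + 1))).
Proof.
move=> kA; apply/mapP/andP => [[m' + [-> ->]]|[om /eqP ->]]; first by rewrite mem_occl // eqxx.
by exists m; rewrite ?mem_occl.
Qed.

End Encode.

(** A right-pointing triangle is paired along the walker leaving its vertical side, a left-pointing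
    one along the walker arriving there; without a walker it is half of a horizontal lozenge. *)
Definition decH (r : seq (seq (int * bool))) (k : nat) (m : int) : tri :=
  let c := nth [::] r k in
  if odd (k + `|m|) then
    if (m, true) \in c then (k%:Z, m + 1)
    else if (m, false) \in c then (k%:Z, m - 1) else (k%:Z - 1, m)
  else
    if (m - 1, true) \in c then (k%:Z, m - 1)
    else if (m + 1, false) \in c then (k%:Z, m + 1) else (k%:Z + 1, m).

(** Right of the axis the partner is obtained by rotation, which builds in the invariance. *)
Definition dec r (t : tri) : tri :=
  if t.1 < A%:Z then decH r (absz t.1) t.2 else rot (decH r (absz (rot t).1) (rot t).2).

Lemma half_or_rot t : t \in R ->
  (exists2 k : nat, (k < A)%N & t = (k%:Z, t.2)) \/
  (exists2 k : nat, (k < A)%N & [/\ (k%:Z, - t.2) \in R, t = rot (k%:Z, - t.2) & A%:Z <= t.1]).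
Proof.
case: t => k m tR; have /andP[/= t0 tA] := R_box tR; have [tl|tl] := ltrP k A%:Z.
  left; exists (absz k); first by move: t0 tl; clear; lia.
  by rewrite gez0_abs.
right; exists (absz ((2 * A)%N%:Z - 1 - k)%R); first by move: tl tA; clear; lia.
have e : (k, m) = rot ((absz ((2 * A)%N%:Z - 1 - k)%R)%:Z, - m).
  by rewrite /rot180 /= opprK; congr (_, _); move: tA tl; clear; lia.
by split=> //; rewrite -R_rot -e.
Qed.

Lemma dec_half r (k : nat) m : (k < A)%N -> dec r (k%:Z, m) = decH r k m.
Proof. by move=> kA; rewrite /dec /= ltz_nat kA. Qed.

Lemma dec_rot r t : t \in R -> dec r (rot t) = rot (dec r t).
Proof.
case/half_or_rot => -[k kA]; first move=> ->; last case=> _ -> _.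
  rewrite dec_half // /dec rot180K /=; case: ifP => //.
  by rewrite /rot180 /= => h; exfalso; move: h kA; clear; lia.
rewrite rot180K dec_half // /dec rot180K; case: ifP => [|_]; last by rewrite /= rot180K.
by rewrite /rot180 /= => h; exfalso; move: h kA; clear; lia.
Qed.

Lemma dec_enc F t : tilingF F -> t \in R -> F t = dec (enc F) t.
Proof.
move=> tF.
suff half k m : (k < A)%N -> (k%:Z, m) \in R -> F (k%:Z, m) = dec (enc F) (k%:Z, m).
  move=> tR; case: (half_or_rot tR) => -[k kA]; first by move=> e; rewrite e in tR *; apply: half.
  case=> uR -> _; have [_ _ _ ->] := tF _ uR; rewrite dec_rot //; congr (rot _); exact: half.
move=> kA mR; rewrite dec_half // /decH /enc (nth_map 0%N) ?size_iota // nth_iota // add0n.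
have kne (x y : int) : ((k%:Z, x) == (k%:Z - 1, y)) = false.
  by rewrite xpair_eqE; apply/negbTE; rewrite negb_and; apply/orP; left; clear; lia.
case: ifPn => om.
  rewrite !mem_colF // /occ om mR /=.
  case: (right_cases tF mR om) => ->; rewrite ?kne ?eqxx //=.
  have -> : ((k%:Z, m - 1) == (k%:Z, m + 1)) = false.
    by rewrite xpair_eqE eqxx /=; apply/negbTE; clear; lia.
  by [].
have no x b : (x, b) \in colF F k -> step (x, b) = m -> F (k%:Z, m) = (k%:Z, x).
  by move=> xc xm; have [_ _ _ _] := colF_step tF kA xc; rewrite xm.
have [Fm|Fm|Fm] := left_cases tF mR om.
- case: ifPn => [/no|_].
    by rewrite /step /= subrK Fm => /(_ erefl) [e]; exfalso; move: e; clear; lia.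
  case: ifPn => // /negP[]; have [FR _ FK _] := tF _ mR; rewrite Fm in FR FK.
  rewrite mem_colF // /occ FR FK kne xpair_eqE eqxx /= andbT eq_sym.
  apply/andP; split; first by move: om; clear; lia.
  by clear; lia.
- case: ifPn => // /negP[]; have [FR _ FK _] := tF _ mR; rewrite Fm in FR FK.
  rewrite mem_colF // /occ FR FK kne xpair_eqE subrK !eqxx /= andbT.
  by move: om; clear; lia.
- have kne1 x : ((k%:Z + 1, m) = (k%:Z, x)) -> False by case=> e _; move: e; clear; lia.
  case: ifPn => [/no|_]; first by rewrite /step /= subrK Fm => /(_ erefl) /kne1.
  by case: ifPn => [/no|//]; rewrite /step /= addrK Fm => /(_ erefl) /kne1.
Qed.

(** * From runs to tilings *)

Section Decode.
Variable r : seq (seq (int * bool)).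
Hypothesis vr : valid ok2 inj2 final2 0 (start2 B) r.
Hypothesis szr : size r = A.
Let c k := nth [::] r k.
Let st k := if k is k'.+1 then inj2 k (mv (c k')) else start2 B.

Lemma unzip1_c k : (k < A)%N -> unzip1 (c k) = st k.
Proof.
by move=> kA; have [h _] := valid_nthP vr; have [|-> _] := h k; rewrite ?szr // add0n.
Qed.

Lemma ok2_c k : (k < A)%N -> ok2 k.+1 (mv (c k)).
Proof. by move=> kA; have [h _] := valid_nthP vr; have [|_] := h k; rewrite ?szr // add0n. Qed.

Lemma final2_st : final2 (st A).
Proof. by have [_] := valid_nthP vr; rewrite szr add0n. Qed.

Lemma Inv2_st k : (k <= A)%N -> Inv2 A B ks k (st k).
Proof.
elim: k => [|k IHk] kA; first exact: Inv2_start.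
have := @step2 A B n ks hole_lineA k (st k) (c k) kA (IHk (ltnW kA)) (unzip1_c kA).
by rewrite ok2_c // => -[].
Qed.

Lemma mem_st k m : (k < A)%N ->
  (m \in st k.+1) = (m \in mv (c k)) || (hole_line k.+1 && (`|m| == 1)).
Proof.
move=> kA; rewrite /st /inj2; case: (boolP (hole_line k.+1)) => hk; last by rewrite orbF.
rewrite !mem_cat !mem_filter !inE /=.
case: (boolP (m \in mv _)) => [mm|_] /=; last by rewrite !andbF /=; clear; lia.
have : m != 0; last by clear; lia.
have /andP[_ /allP /(_ _ mm) /and3P[_ + _]] := ok2_c kA.
by rewrite /half_hole hk; apply: contraNneq => ->; rewrite orbT.
Qed.

Lemma st_right k m : (k < A)%N -> m \in st k -> odd (k + `|m|) && half_reg k m.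
Proof.
move=> kA ms; have [_ /allP /(_ _ ms) om _ _] := Inv2_st (ltnW kA); rewrite om /=.
case: k kA ms om => [|k] kA; first by move=> ms om; rewrite (@half_reg_start A B n ks nA m A0 om).
rewrite mem_st ?(ltnW kA) // => /orP[mm|/andP[hk /eqP m1]] om; last exact: (@half_reg_inj A B n ks).
have /andP[_ /allP /(_ _ mm) /= rm] := ok2_c (ltnW kA).
by move: rm; rewrite (@half_regS A B n ks npar k m kA) => [/andP[]|]; last by move: om.
Qed.

Lemma c_step k e : (k < A)%N -> e \in c k ->
  [/\ odd (k + `|e.1|), (k%:Z, e.1) \in R & (k%:Z, step e) \in R].
Proof.
move=> kA ec; have : e.1 \in st k by rewrite -unzip1_c // map_f.
case/(st_right kA)/andP => oe re; rewrite !R_half // re; split=> //.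
by have /andP[_ /allP] := ok2_c kA; apply; apply: map_f.
Qed.

Lemma c_uniq k m : (k < A)%N -> (m, true) \in c k -> (m, false) \in c k -> False.
Proof.
move=> kA; have [sst _ _ _] := Inv2_st (ltnW kA).
have : uniq (unzip1 (c k)) by rewrite unzip1_c // (sorted_uniq lt_trans lt_irreflexive).
elim: (c k) => //= e s IHs /andP[es us]; rewrite !inE.
case/orP => [/eqP e1|m1] /orP[/eqP e2|m2]; last exact: IHs.
- by rewrite -e1 in e2.
- by case/negP: es; rewrite -e1; apply: (map_f fst m2).
- by case/negP: es; rewrite -e2; apply: (map_f fst m1).
Qed.

Lemma step_inj k e e' : (k < A)%N -> e \in c k -> e' \in c k -> step e = step e' -> e = e'.
Proof.
move=> kA; have /andP[+ _] := ok2_c kA => /(sorted_uniq lt_trans lt_irreflexive).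
rewrite /mv; elim: (c k) => //= x s IHs /andP[xs us]; rewrite !inE.
case/orP => [/eqP->|es] /orP[/eqP->|es'] // se; last exact: IHs.
- by case/negP: xs; rewrite se map_f.
- by case/negP: xs; rewrite -se map_f.
Qed.

Lemma mem_st_c k m : (k < A)%N -> (m \in st k) = ((m, true) \in c k) || ((m, false) \in c k).
Proof.
move=> kA; rewrite -unzip1_c //; apply/mapP/orP => [[[x []] xc ->]|[] mc]; [by left|by right| |].
  by exists (m, true).
by exists (m, false).
Qed.

Lemma mem_mv_c k m : (m \in mv (c k)) = ((m - 1, true) \in c k) || ((m + 1, false) \in c k).
Proof.
apply/mapP/orP => [[[x []] xc ->]|[] mc]; rewrite /step /= ?addrK ?subrK; [by left|by right| |].
  by exists (m - 1, true) => //; rewrite /step /= subrK.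
by exists (m + 1, false) => //; rewrite /step /= addrK.
Qed.

(** The left side of the hexagon and the vertical sides of holes all emit walkers, so a side without
    one has a left neighbour in the region. *)
Lemma right_free k m : (k < A)%N -> odd (k + `|m|) -> half_reg k m -> m \notin st k ->
  exists k', [/\ k = k'.+1, half_reg k' m & m \notin mv (c k')].
Proof.
case: k => [|k] kA om rm; first by rewrite /st -(@half_reg_start A B n ks nA m A0 om) rm.
rewrite mem_st ?(ltnW kA) // negb_or => /andP[mm h1]; exists k; split=> //.
rewrite (@half_regS A B n ks npar k m kA) ?rm /=; last by move: om => /=.
apply: contra h1 => /andP[hk m1]; rewrite hk /=.
by have := hole_line_even hk; move: om m1 => /=; clear; lia.
Qed.

Lemma left_free k m : (k.+1 < A)%N -> ~~ odd (k + `|m|) -> half_reg k m -> m \notin mv (c k) ->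
  half_reg k.+1 m && (m \notin st k.+1).
Proof.
move=> kA om rm nm; move: (rm); rewrite (@half_regS A B n ks npar k m kA) // => /andP[-> nh] /=.
rewrite mem_st ?(ltnW kA) // (negPf nm) /=; apply: contra nh => /andP[-> /eqP ->] /=.
by [].
Qed.

(** Symmetry of the end points: a horizontal lozenge across the axis needs its rotated image, at the
    opposite height, to be free too. *)
Lemma final_free m : ~~ odd (A.-1 + `|m|) -> half_reg A.-1 m -> m \notin mv (c A.-1) ->
  - m \notin mv (c A.-1).
Proof.
have A1 : (A.-1 < A)%N by rewrite prednK.
move=> om rm; apply: contra => mm; have := final2_st.
rewrite -(prednK A0) => /allP /(_ (- m)); rewrite !mem_st // mm => /(_ isT) /andP[+ _].
rewrite opprK => /orP[//|/andP[hk /eqP m1]].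
by case/and3P: rm => _; rewrite /half_hole hk m1 lexx orbT.
Qed.

Lemma decH_right k m : (k < A)%N -> odd (k + `|m|) ->
  [/\ (m, true) \in c k -> decH r k m = (k%:Z, m + 1),
      (m, false) \in c k -> decH r k m = (k%:Z, m - 1) &
      m \notin st k -> decH r k m = (k%:Z - 1, m)].
Proof.
move=> kA om; rewrite mem_st_c // /decH om -/(c k); split=> [->|mf|] //.
  by case: ifP => [mt|_]; [case: (c_uniq kA mt mf) | rewrite mf].
by rewrite negb_or => /andP[/negPf -> /negPf ->].
Qed.

Lemma decH_left k m : (k < A)%N -> ~~ odd (k + `|m|) ->
  [/\ (m - 1, true) \in c k -> decH r k m = (k%:Z, m - 1),
      (m + 1, false) \in c k -> decH r k m = (k%:Z, m + 1) &
      m \notin mv (c k) -> decH r k m = (k%:Z + 1, m)].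
Proof.
move=> kA om; rewrite mem_mv_c /decH (negPf om) -/(c k); split=> [->|mf|] //.
  case: ifP => [mt|_]; last by rewrite mf.
  by have := step_inj kA mt mf; rewrite /step /= subrK addrK => /(_ erefl).
by rewrite negb_or => /andP[/negPf -> /negPf ->].
Qed.

Lemma dec_half_tiling k m : (k < A)%N -> (k%:Z, m) \in R ->
  [/\ dec r (k%:Z, m) \in R, adjacent (k%:Z, m) (dec r (k%:Z, m))
    & dec r (dec r (k%:Z, m)) = (k%:Z, m)].
Proof.
move=> kA mR; rewrite dec_half //; have rm := mR; rewrite R_half // in rm.
rewrite adjacentE left_pointingE /=; have [om|om] := boolP (odd (k + `|m|)) => /=.
  have [dt df dn] := decH_right kA om; have [|ms] := boolP (m \in st k).
    rewrite mem_st_c // => /orP[] mc; have [_ _] := c_step kA mc; rewrite /step /= => sR.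
      rewrite (dt mc) eqxx dec_half //; split=> //.
      have om' : ~~ odd (k + `|m + 1|) by move: om; clear; lia.
      by have [+ _ _] := decH_left kA om'; rewrite addrK; apply.
    rewrite (df mc) eqxx orbT dec_half //; split=> //.
    have om' : ~~ odd (k + `|m - 1|) by move: om; clear; lia.
    by have [_ + _] := decH_left kA om'; rewrite subrK; apply.
  rewrite (dn ms) eqxx !orbT; have [k' [kk' rk' nm]] := right_free kA om rm ms.
  have kA' : (k' < A)%N by rewrite ltnW // -kk'.
  have e : k%:Z - 1 = k'%:Z by rewrite kk'; clear; lia.
  rewrite e R_half // rk'; split=> //; rewrite dec_half //.
  have om' : ~~ odd (k' + `|m|) by move: om; rewrite kk'.
  by have [_ _ ->] := decH_left kA' om'; rewrite // -e subrK.
have [dt df dn] := decH_left kA om; have [|mm] := boolP (m \in mv (c k)).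
  rewrite mem_mv_c => /orP[] mc; have [/= oe eR _] := c_step kA mc.
    rewrite (dt mc) eqxx orbT dec_half //; split=> //.
    by have [+ _ _] := decH_right kA oe; rewrite subrK; apply.
  rewrite (df mc) eqxx dec_half //; split=> //.
  by have [_ + _] := decH_right kA oe; rewrite addrK; apply.
rewrite (dn mm) eqxx !orbT.
have e : k%:Z + 1 = k.+1%:Z by clear; lia.
have [kA1|Ak] := ltnP k.+1 A.
  have /andP[r1 s1] := left_free kA1 om rm mm.
  rewrite e R_half // r1 dec_half //; split=> //.
  have om' : odd (k.+1 + `|m|) by move: om => /=.
  by have [_ _ ->] := decH_right kA1 om'; rewrite // -e addrK.
(* In the last strip the horizontal lozenge crosses the axis, and its right half is a rotated
   triangle of the same strip. *)
have kE : k = A.-1 by move: kA Ak; clear; lia.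
have rE : (k%:Z + 1, m) = rot (k%:Z, - m).
  by rewrite /rot180 /= opprK; congr (_, _); move: kA Ak; clear; lia.
have uR : (k%:Z, - m) \in R by rewrite R_half // half_regN.
rewrite rE R_rot uR dec_rot // dec_half //; split=> //.
have om' : ~~ odd (k + `|- m|) by rewrite abszN.
have nm' : - m \notin mv (c k) by rewrite kE in om rm mm *; apply: final_free.
have [_ _ ->] := decH_left kA om' => //.
by rewrite /rot180 /= opprK; congr (_, _); move: kA Ak; clear; lia.
Qed.

Lemma dec_tiling : tilingF (dec r).
Proof.
move=> t tR; have dr := dec_rot r tR.
suff [h1 h2 h3] : [/\ dec r t \in R, adjacent t (dec r t) & dec r (dec r t) = t] by split.
case: (half_or_rot tR) => -[k kA]; first by move=> e; rewrite e in tR *; apply: dec_half_tiling.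
case=> uR -> _; have [h1 h2 h3] := dec_half_tiling kA uR.
by rewrite dec_rot // R_rot adjacent_rot dec_rot // h3.
Qed.

Lemma enc_dec : enc (dec r) = r.
Proof.
apply: (@eq_from_nth _ [::]); first by rewrite size_map size_iota szr.
move=> k; rewrite size_map size_iota => kA.
rewrite (nth_map 0%N) ?size_iota // nth_iota // add0n -/(c k).
have oE : occl (dec r) k = unzip1 (c k).
  rewrite unzip1_c //; apply: lt_sorted_eq; first exact: sorted_occl.
    by have [] := Inv2_st (ltnW kA).
  move=> m; rewrite mem_occl // /occ R_half // dec_half //.
  apply/and3P/idP => [[om rm]|ms]; first apply: contraNT => ms.
    by have [_ _ ->] := decH_right kA om.
  have /andP[om rm] := st_right kA ms; split=> //.
  have [dt df _] := decH_right kA om.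
  by move: ms; rewrite mem_st_c // => /orP[/dt|/df] ->; rewrite xpair_eqE negb_and; apply/orP; left; clear; lia.
rewrite /colF oE -map_comp; apply: map_id_in => -[m b] mc /=; congr (_, _).
have [/= om _ _] := c_step kA mc; have [dt df _] := decH_right kA om; rewrite dec_half //.
case: b mc => mc; first by rewrite dt // eqxx.
by rewrite df // xpair_eqE eqxx /=; apply/negbTE; clear; lia.
Qed.

End Decode.

Lemma R_flipH t : (flipH t \in R) = (t \in R).
Proof.
suff imp u : u \in R -> flipH u \in R.
  by apply/idP/idP => [/imp|/imp //]; rewrite flipHK.
move=> uR; case: (half_or_rot uR) => -[k kA]; first by move=> e; move: uR; rewrite e !R_half // half_regN.
by case=> vR e _; rewrite e flipH_rot R_rot; move: vR; rewrite /flipH /= !R_half // !half_regN.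
Qed.

Definition flipF (F : tri -> tri) (t : tri) : tri := flipH (F (flipH t)).

Lemma flipF_tiling F : tilingF F -> tilingF (flipF F).
Proof.
move=> tF t tR; have tR' : flipH t \in R by rewrite R_flipH.
have [h1 h2 h3 h4] := tF _ tR'; rewrite /flipF; split.
- by rewrite R_flipH.
- by rewrite -{1}[t]flipHK adjacent_flipH.
- by rewrite flipHK h3 flipHK.
- by rewrite flipH_rot h4 flipH_rot.
Qed.

Lemma eq_enc F F' : {in R, F =1 F'} -> enc F = enc F'.
Proof.
move=> eF; apply/eq_in_map => k; rewrite mem_iota add0n => /andP[_ kA].
have oE : occl F k = occl F' k.
  apply: eq_filter => m; rewrite /occ; case: (boolP (_ \in R)) => mR; last by rewrite !andbF.
  by rewrite eF.
rewrite /colF oE; apply/eq_in_map => m; rewrite mem_occl // => /and3P[_ mR _].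
by rewrite eF.
Qed.

Lemma enc_flipF F : tilingF F -> enc (flipF F) = [seq rev (map flipc c) | c <- enc F].
Proof.
move=> tF; rewrite /enc -map_comp; apply/eq_in_map => k; rewrite mem_iota add0n => /andP[_ kA] /=.
have flipE (x y : tri) : (flipH x == y) = (x == flipH y).
  by apply/eqP/eqP => [<-|->]; rewrite flipHK.
have oE : occl (flipF F) k = rev (map -%R (occl F k)).
  apply: lt_sorted_eq; first exact: sorted_occl.
    rewrite rev_sorted sorted_map; apply: sub_sorted (sorted_occl F k) => x y /=; by rewrite ltrN2.
  move=> m; rewrite mem_rev mem_occl // -[m in RHS]opprK mem_map; last exact: oppr_inj.
  rewrite mem_occl // /occ abszN flipE /flipH /=; congr [&& _, _ & _].
  exact: (esym (R_flipH (k%:Z, m))).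
rewrite /colF oE map_rev -map_comp -[in RHS]map_comp; congr rev.
apply/eq_in_map => m; rewrite mem_occl // => /and3P[om mR mF] /=; rewrite /flipc /=; congr (_, _).
rewrite flipE /flipH /= opprD !opprK.
case: (right_cases tF mR om) => e; rewrite e ?eqxx // in mF *; rewrite !xpair_eqE eqxx /=.
  by clear; lia.
by clear; lia.
Qed.

(** Since [reflV] is [flipH] followed by the rotation, invariance under it amounts to invariance
    under [flipH], which acts on columns by reversing and flipping. *)
Lemma refl_symcol F : tilingF F ->
  ({in R, forall t, F (reflV A t) = reflV A (F t)} <-> all symcol (enc F)).
Proof.
move=> tF; have tF' := flipF_tiling tF; have eF := enc_flipF tF; split=> [reflF|symF].
  have e : enc (flipF F) = enc F.
    apply: eq_enc => t tR; have tR' : flipH t \in R by rewrite R_flipH.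
    have := reflF t tR; rewrite -!rot_flipH; have [_ _ _ ->] := tF _ tR'.
    by move/(can_inj (rot180K A)) => e; rewrite /flipF e flipHK.
  apply/allP => c /(nthP [::]) [i iA <-]; rewrite /symcol -{1}e eF (nth_map [::]) //.
have e : enc (flipF F) = enc F.
  by rewrite eF -[RHS]map_id; apply/eq_in_map => c /(allP symF) /eqP <-.
move=> t tR; have tR' : flipH t \in R by rewrite R_flipH.
rewrite -!rot_flipH; have [_ _ _ ->] := tF _ tR'; congr (rot _).
rewrite (dec_enc tF tR) -e -(dec_enc tF') // /flipF flipHK //.
Qed.

Definition toF (f : {ffun R -> R}) (t : tri) : tri := oapp (fun u : R => val (f u)) t (insub t).
Definition fromF (F : tri -> tri) : {ffun R -> R} := [ffun u => insubd u (F (val u))].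

Lemma toFE f (u : R) : toF f (val u) = val (f u).
Proof. by rewrite /toF valK. Qed.

Lemma toF_fromF F t : (forall u, u \in R -> F u \in R) -> t \in R -> toF (fromF F) t = F t.
Proof.
move=> FR tR; have -> : t = val [` tR]%fset by [].
by rewrite toFE ffunE val_insubd FR //= tR.
Qed.

Lemma tiling_toF (f : {ffun R -> R}) :
  reflect (tilingF (toF f)) (is_tiling f && all (fun sg => invariant_under sg f) [:: rot]).
Proof.
apply: (iffP idP) => [/and3P[/forallP tf /forallP invf _] t tR|tF].
  have -> : t = val [` tR]%fset by [].
  set u := [` tR]%fset; have /andP[adj /eqP ff] := tf u.
  have rR : rot (val u) \in R by rewrite R_rot.
  split; rewrite ?toFE //; [exact: valP | by rewrite ff |].
  have -> : rot (val u) = val [` rR]%fset by [].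
  by rewrite toFE; have /forallP/(_ [` rR]%fset)/implyP/(_ (eqxx _))/eqP := invf u.
apply/and3P; split=> //.
  apply/forallP => u; have [_ + + _] := tF _ (valP u); rewrite !toFE => -> e /=.
  by apply/eqP/val_inj.
apply/forallP => t; apply/forallP => u; apply/implyP => /eqP e.
by have [_ _ _] := tF _ (valP t); rewrite -e !toFE => ->.
Qed.

Let S := [set f : {ffun R -> R} | is_tiling f && all (fun sg => invariant_under sg f) [:: rot]].

(** Encoding is injective by [dec_enc] and reaches every run by [enc_dec]. *)
Lemma perm_enc_runs :
  perm_eq [seq enc (toF f) | f <- enum S] (runs ok2 inj2 final2 0 A (start2 B)).
Proof.
apply: uniq_perm; last 1 first.
- move=> r; apply/mapP/idP => [[f]|].
    rewrite mem_enum inE => /tiling_toF tf ->; rewrite mem_runs valid_enc // andbT.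
    by rewrite size_map size_iota.
  rewrite mem_runs => /andP[/eqP szr vr]; have tD := dec_tiling vr szr.
  have e : {in R, toF (fromF (dec r)) =1 dec r}.
    by move=> t tR; apply: toF_fromF => // u uR; have [] := tD u uR.
  exists (fromF (dec r)); last by rewrite (eq_enc e) enc_dec.
  rewrite mem_enum inE; apply/tiling_toF => t tR; have [h1 h2 h3 h4] := tD t tR.
  by rewrite !e ?R_rot.
- rewrite map_inj_in_uniq ?enum_uniq // => f f'; rewrite !mem_enum !inE => /tiling_toF tf /tiling_toF tf' ee.
  apply/ffunP => u; apply: val_inj; rewrite -!toFE.
  by rewrite (dec_enc tf (valP u)) (dec_enc tf' (valP u)) ee.
- exact: uniq_runs.
Qed.

Lemma Msym_rot : Msym R [:: rot] = count2 A B n ks 0 A (start2 B).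
Proof.
by rewrite /count2 -size_runs -(perm_size perm_enc_runs) size_map -cardE.
Qed.

Lemma Msym_rot_refl : Msym R [:: rot; reflV A] = count1 A B n ks 0 A (start1 B).
Proof.
rewrite -size_symruns; last by apply/allP => t /start1P /and3P[].
rewrite -[mirror _]/(start2 B) size_filter -(seq.permP perm_enc_runs) count_map -size_filter.
have uS : uniq [seq f <- enum S | preim (fun f => enc (toF f)) (all symcol) f].
  by rewrite filter_uniq // enum_uniq.
rewrite -(card_uniqP uS) /Msym; apply: eq_card => f; rewrite !inE mem_filter mem_enum.
have -> : (f \in S) = is_tiling f && invariant_under rot f by rewrite inE /= andbT.
rewrite /= !andbT andbA [RHS]andbC.
case: (boolP (is_tiling f && invariant_under rot f)) => //= tf.
have tF : tilingF (toF f) by apply/tiling_toF; rewrite /= andbT.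
apply/idP/idP => [/forallP invf|sF].
  suff h : {in R, forall t, toF f (reflV A t) = reflV A (toF f t)}.
    exact: (iffLR (refl_symcol tF) h).
  move=> t tR; have -> : t = val [` tR]%fset by [].
  have rR : reflV A (val [` tR]%fset) \in R by rewrite -rot_flipH R_rot R_flipH.
  have -> : reflV A (val [` tR]%fset) = val [` rR]%fset by [].
  by rewrite !toFE; have /forallP/(_ [` rR]%fset)/implyP/(_ (eqxx _))/eqP := invf [` tR]%fset.
apply/forallP => t; apply/forallP => u; apply/implyP => /eqP e.
by have := iffRL (refl_symcol tF) sF _ (valP t); rewrite -e !toFE => ->.
Qed.

Lemma Msym_square : Msym R [:: rot] = (Msym R [:: rot; reflV A] ^ 2)%N.
Proof. by rewrite Msym_rot Msym_rot_refl count_sq. Qed.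

End Bijection.

(** * The regions *)

Lemma tri_in_hex_bounds A B (k m : int) : tri_in (in_hex A B) (k, m) ->
  [&& 0 <= k, k < (2 * A)%N%:Z & `|m| <= (2 * B + A)%N%:Z].
Proof. by rewrite /tri_in /tri_vertices /in_hex; case: ifP => _ /=; lia. Qed.

Lemma tri_in_hex_box A B (t : tri) : tri_in (in_hex A B) t -> t \in box A B.
Proof.
case: t => k m /tri_in_hex_bounds /and3P[k0 kA mB].
apply/allpairsP; exists (absz k, absz (m + (2 * B + A)%N%:Z)%R).
split; rewrite ?[(_, _).1]/= ?[(_, _).2]/= ?mem_iota.
- by move: k0 kA; clear; lia.
- by move: mB; clear; lia.
by congr (_, _); [move: k0; clear; lia | move: mB; clear; lia].
Qed.

Lemma mem_HregR A B ks n (t : tri) : (t \in HregR A B ks n)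
  = [&& tri_in (in_hex A B) t, ~~ in_holes A ks t & ~~ tri_in (in_rhomb A%:Z n) t].
Proof.
apply/imfsetP/idP => [[u] |h]; first by rewrite /= mem_filter => /andP[h _] ->.
by exists t => //=; rewrite mem_filter h tri_in_hex_box //; case/andP: h.
Qed.

Lemma mem_Hreg A B ks (t : tri) :
  (t \in Hreg A B ks) = tri_in (in_hex A B) t && ~~ in_holes A ks t.
Proof.
apply/imfsetP/idP => [[u] |h]; first by rewrite /= mem_filter => /andP[h _] ->.
by exists t => //=; rewrite mem_filter h tri_in_hex_box //; case/andP: h.
Qed.

(** A rhombus of side 0 contains no unit triangle, so both identities are cases of one statement. *)
Lemma Hreg_HregR A B ks : Hreg A B ks = HregR A B ks 0.
Proof.
apply/fsetP => t; rewrite mem_Hreg mem_HregR.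
suff -> : tri_in (in_rhomb A%:Z 0) t = false by rewrite andbT.
by case: t => k m; rewrite /tri_in /tri_vertices /in_rhomb; case: ifP => _ /=; clear; lia.
Qed.

Lemma tri_in_hex A B (k : nat) m : (k < A)%N ->
  tri_in (in_hex A B) (k%:Z, m) = (`|m| <= (2 * B + k)%N%:Z).
Proof.
move=> kA; rewrite /tri_in /tri_vertices left_pointingE /in_hex.
by case: (boolP (odd _)) => om /=; move: om kA; clear; lia.
Qed.

(** For positive [n] the parity condition puts the sides of the rhombus on lattice lines, so a
    single inequality decides for the whole triangle. *)
Lemma tri_in_rhomb A n (k : nat) m : (k < A)%N -> (n == 0%N) || (odd n == odd A) ->
  tri_in (in_rhomb A%:Z n) (k%:Z, m) = ~~ (n%:Z < A%:Z - k%:Z + `|m|).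
Proof.
move=> kA npar; rewrite /tri_in /tri_vertices left_pointingE /in_rhomb.
by case: (boolP (odd _)) => om /=; move: om kA npar; clear; lia.
Qed.

Lemma tri_in_ltri2 (j k : nat) m :
  tri_in (in_ltri2 ((2 * j)%N%:Z - 2)) (k%:Z, m)
  = ((k.+2 == 2 * j)%N && (m == 0)) || ((k.+1 == 2 * j)%N && (`|m| <= 1)).
Proof.
rewrite /tri_in /tri_vertices left_pointingE /in_ltri2.
by case: (boolP (odd _)) => om /=; move: om; clear; lia.
Qed.

Lemma tri_in_rtri2 (A j k : nat) m : (k < A)%N -> (2 * j <= A)%N ->
  tri_in (in_rtri2 ((2 * A)%N%:Z - (2 * j)%N%:Z)) (k%:Z, m) = false.
Proof.
move=> kA jA; rewrite /tri_in /tri_vertices left_pointingE /in_rtri2.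
by case: (boolP (odd _)) => om /=; move: kA jA; clear; lia.
Qed.

Lemma in_holes_half A ks (k : nat) m : (k < A)%N -> all (fun j => 2 * j <= A)%N ks ->
  in_holes A ks (k%:Z, m) = half_hole ks k m.
Proof.
move=> kA /allP ksA; rewrite /in_holes /half_hole /hole_line.
apply/hasP/idP => [[j jks]|].
  rewrite tri_in_rtri2 ?orbF ?tri_in_ltri2 //; last exact: ksA.
  case/orP => /andP[/eqP e ->]; [apply/orP; left | apply/orP; right]; rewrite andbT e.
    by rewrite mul2n odd_double doubleK.
  by rewrite mul2n odd_double doubleK.
case/orP => /andP[/andP[ok ks2] mm]; [exists k.+2./2 | exists k.+1./2] => //;
  rewrite tri_in_ltri2 mm !andbT; apply/orP; left; apply/orP; [left|right]; move: ok; clear; lia.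
Qed.

Lemma tri_in_hex_rot A B t : tri_in (in_hex A B) (rot180 A t) = tri_in (in_hex A B) t.
Proof.
rewrite /tri_in /tri_vertices left_pointing_rot /in_hex /rot180; case: t => k m /=.
by case: left_pointing => /=; clear; lia.
Qed.

Lemma tri_in_rhomb_rot A n t : tri_in (in_rhomb A%:Z n) (rot180 A t) = tri_in (in_rhomb A%:Z n) t.
Proof.
rewrite /tri_in /tri_vertices left_pointing_rot /in_rhomb /rot180; case: t => k m /=.
by case: left_pointing => /=; clear; lia.
Qed.

Lemma in_holes_rot A ks t : in_holes A ks (rot180 A t) = in_holes A ks t.
Proof.
apply: eq_has => j; rewrite orbC; congr (_ || _).
  rewrite /tri_in /tri_vertices left_pointing_rot /in_rtri2 /in_ltri2 /rot180; case: t => k m /=.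
  by case: left_pointing => /=; clear; lia.
rewrite /tri_in /tri_vertices left_pointing_rot /in_rtri2 /in_ltri2 /rot180; case: t => k m /=.
by case: left_pointing => /=; clear; lia.
Qed.

Lemma Msym_HregR_square A B ks n : (0 < A)%N -> (n <= A)%N -> (n == 0%N) || (odd n == odd A) ->
  all (fun j => (0 < j) && (2 * j + n <= A))%N ks ->
  Msym (HregR A B ks n) [:: rot180 A] = (Msym (HregR A B ks n) [:: rot180 A; reflV A] ^ 2)%N.
Proof.
move=> A0 nA npar /allP ksP; apply: (@Msym_square A B n ks) => //.
- move=> k /andP[ok /ksP]; move: ok; clear; lia.
- move=> k m kA; rewrite mem_HregR tri_in_hex // in_holes_half //; last first.
    by apply/allP => j /ksP; clear; lia.
  by rewrite tri_in_rhomb // negbK.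
- by move=> t; rewrite !mem_HregR tri_in_hex_rot in_holes_rot tri_in_rhomb_rot.
- by move=> [k m]; rewrite mem_HregR => /andP[/tri_in_hex_bounds /and3P[-> -> _] _].
Qed.

(* A hole whose vertical side lies strictly inside the rhombus is contained in the rhombus. *)
Lemma HregR_filter A B ks n : odd n == odd A -> all (fun j => 2 * j <= A)%N ks ->
  HregR A B ks n = HregR A B [seq j <- ks | (2 * j + n <= A)%N] n.
Proof.
move=> npar /allP ksA; apply/fsetP => t; rewrite !mem_HregR; congr (_ && _).
case: (boolP (tri_in (in_rhomb A%:Z n) t)) => nr; rewrite ?andbF // !andbT; congr (~~ _).
apply/hasP/hasP => [[j jks tj]|[j]]; last by rewrite mem_filter => /andP[_ jks] tj; exists j.
exists j => //; rewrite mem_filter jks andbT; apply: contraNT nr => jn; move: tj (ksA _ jks) npar jn.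
case: t => k m; rewrite /tri_in /tri_vertices /in_ltri2 /in_rtri2 /in_rhomb.
by case: ifP => _ /=; clear; lia.
Qed.

Local Close Scope ring_scope.

Theorem theorem2p1 (a b s x : nat) (ks : seq nat) :
  (0 < a)%N -> (0 < b)%N -> (0 < s)%N -> (0 < x)%N -> (x <= a)%N ->
  size ks = s -> sorted ltn ks -> all (fun k => 0 < k)%N ks ->
  all (fun k => k.*2 <= a)%N ks ->
  Msym (Hreg a b ks) [:: rot180 a]
    = (Msym (Hreg a b ks) [:: rot180 a; reflV a]) ^ 2
  /\
  Msym (HregR (2 * a - 1) b ks (2 * x - 1)) [:: rot180 (2 * a - 1)]
    = (Msym (HregR (2 * a - 1) b ks (2 * x - 1)) [:: rot180 (2 * a - 1); reflV (2 * a - 1)]) ^ 2.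
Proof.
move=> a0 _ _ x0 xa _ _ /allP ks0 /allP ksa; split.
  rewrite Hreg_HregR; apply: Msym_HregR_square => //.
  by apply/allP => k kks; rewrite ks0 //= addn0 mul2n ksa.
have odd_n : odd (2 * x - 1) == odd (2 * a - 1) by move: a0 x0; clear; lia.
(* Dropping the holes hidden in the rhombus leaves those whose vertical side is not beyond its left
   corner. *)
rewrite HregR_filter //; last by apply/allP => k /ksa; move: a0; clear; lia.
apply: Msym_HregR_square; rewrite ?odd_n ?orbT //; try by move: a0 xa; clear; lia.
by apply/allP => k; rewrite mem_filter => /andP[-> /ks0 ->].
Qed.
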